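(* Work in $\mathsf{ZF}$. Let $S$ be a set and assume $\mathsf{SVC}(S)$. Let $X$ be a set and $\lambda$ a cardinal such that $\aleph(X)\leq\lambda<\aleph^\ast(X)$. Then either: (1) $\aleph^\ast(X)\leq\aleph^\ast(S)$; or (2) $\lambda=\aleph(X)<\aleph^\ast(X)=\lambda^+$ and $\operatorname{cf}(\lambda)<\aleph^\ast(S)$.
   Context: The base theory is $\mathsf{ZF}$ (no axiom of choice). ''Cardinal'' means an initial ordinal (well-orderable cardinal). $|X|\leq|Y|$ means there is an injection $X\to Y$; $|X|\leq^\ast|Y|$ means there is a surjection $Y\to X$ or $X=\emptyset$. The Hartogs number $\aleph(X)$ is the least ordinal $\alpha$ such that $|\alpha|\nleq|X|$; the Lindenbaum number $\aleph^\ast(X)$ is the least ordinal $\alpha$ such that $|\alpha|\nleq^\ast|X|$. Both are cardinals and $\aleph(X)\leq\aleph^\ast(X)$. $\lambda^+$ is the least cardinal greater than $\lambda$. $\mathsf{SVC}(S)$ is the statement: for every set $X$ there is an ordinal $\eta$ such that $|X|\leq^\ast|S\times\eta|$. *)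

(* Defs.v *)
(** "Work in ZF" is rendered semantically: the theorem is about an arbitrary
    structure [(M, mem)] satisfying the first-order axioms of ZF, equality being
    interpreted as Leibniz equality.  All set-theoretic notions below quantify
    over elements of [M] only, so each of them is a first-order formula of the
    language of set theory, and a statement built from them holds in all such
    [M] iff it is provable in ZF.

    Separation and Replacement are schemas over first-order [formula]s with
    parameters, not over arbitrary predicates [M -> Prop]: with the latter,
    choice in the ambient logic would transfer to the axiom of choice in [M]. *)

Record eps_structure := EpsStructure {
  universe :> Type;
  mem : universe -> universe -> Prop
}.

Arguments mem {e} _ _.
Notation "x '∈' y" := (mem x y) (at level 70, no associativity).

(** Variables are de Bruijn indices; [f_all] and [f_ex] bind index [0]. *)
Inductive formula : Type :=
| f_mem : nat -> nat -> formula
| f_eq : nat -> nat -> formula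
| f_false : formula
| f_and : formula -> formula -> formula
| f_or : formula -> formula -> formula
| f_imp : formula -> formula -> formula
| f_all : formula -> formula
| f_ex : formula -> formula.

Definition scons {A : Type} (x : A) (e : nat -> A) : nat -> A :=
  fun n => match n with O => x | S k => e k end.

Fixpoint sat {M : eps_structure} (e : nat -> M) (phi : formula) : Prop :=
  match phi with
  | f_mem i j => e i ∈ e j
  | f_eq i j => e i = e j
  | f_false => False
  | f_and p q => sat e p /\ sat e q
  | f_or p q => sat e p \/ sat e q
  | f_imp p q => sat e p -> sat e q
  | f_all p => forall x : M, sat (scons x e) p
  | f_ex p => exists x : M, sat (scons x e) p
  end.

Definition is_subset {M : eps_structure} (x y : M) : Prop :=
  forall z : M, z ∈ x -> z ∈ y.

Definition is_empty {M : eps_structure} (x : M) : Prop :=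
  forall z : M, ~ z ∈ x.

Definition is_upair {M : eps_structure} (p x y : M) : Prop :=
  forall z : M, z ∈ p <-> z = x \/ z = y.

(** [s = x ∪ {x}] *)
Definition is_succ {M : eps_structure} (s x : M) : Prop :=
  forall z : M, z ∈ s <-> z ∈ x \/ z = x.

Record ZF (M : eps_structure) : Prop := {
  zf_extensionality :
    forall x y : M, (forall z : M, z ∈ x <-> z ∈ y) -> x = y;
  zf_foundation :
    forall x : M, ~ is_empty x ->
      exists y : M, y ∈ x /\ forall z : M, z ∈ x -> ~ z ∈ y;
  zf_pairing :
    forall x y : M, exists p : M, is_upair p x y;
  zf_union :
    forall x : M, exists u : M,
      forall z : M, z ∈ u <-> exists y : M, y ∈ x /\ z ∈ y;
  zf_power :
    forall x : M, exists p : M, forall z : M, z ∈ p <-> is_subset z x;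
  zf_infinity :
    exists w : M,
      (exists z : M, is_empty z /\ z ∈ w) /\
      (forall x : M, x ∈ w -> exists s : M, is_succ s x /\ s ∈ w);
  zf_separation :
    forall (phi : formula) (e : nat -> M) (a : M),
      exists b : M, forall x : M, x ∈ b <-> x ∈ a /\ sat (scons x e) phi;
  (** [phi] relates the argument (index [1]) to the value (index [0]). *)
  zf_replacement :
    forall (phi : formula) (e : nat -> M) (a : M),
      (forall x y y' : M, x ∈ a ->
         sat (scons y (scons x e)) phi ->
         sat (scons y' (scons x e)) phi -> y = y') ->
      exists b : M, forall y : M,
        y ∈ b <-> exists x : M, x ∈ a /\ sat (scons y (scons x e)) phi
}.

(** Kuratowski pair: [p = {{x}, {x, y}}]. *)
Definition is_pair {M : eps_structure} (p x y : M) : Prop :=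
  forall z : M, z ∈ p <-> is_upair z x x \/ is_upair z x y.

Definition is_product {M : eps_structure} (P A B : M) : Prop :=
  forall p : M,
    p ∈ P <-> exists x y : M, x ∈ A /\ y ∈ B /\ is_pair p x y.

Definition maps_to {M : eps_structure} (f x y : M) : Prop :=
  exists p : M, is_pair p x y /\ p ∈ f.

Definition is_function {M : eps_structure} (f A B : M) : Prop :=
  (forall p : M, p ∈ f -> exists x y : M, x ∈ A /\ y ∈ B /\ is_pair p x y) /\
  (forall x : M, x ∈ A -> exists! y : M, maps_to f x y).

Definition is_injection {M : eps_structure} (f A B : M) : Prop :=
  is_function f A B /\
  forall x x' y : M, maps_to f x y -> maps_to f x' y -> x = x'.

Definition is_surjection {M : eps_structure} (f A B : M) : Prop :=
  is_function f A B /\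
  forall y : M, y ∈ B -> exists x : M, maps_to f x y.

(** |X| ≤ |Y| *)
Definition card_le {M : eps_structure} (X Y : M) : Prop :=
  exists f : M, is_injection f X Y.

(** |X| ≤* |Y| *)
Definition card_le_star {M : eps_structure} (X Y : M) : Prop :=
  (exists f : M, is_surjection f Y X) \/ is_empty X.

Definition equinumerous {M : eps_structure} (X Y : M) : Prop :=
  exists f : M, is_injection f X Y /\ is_surjection f X Y.

(** Transitive sets strictly well-ordered by membership. *)
Definition is_ordinal {M : eps_structure} (a : M) : Prop :=
  (forall x : M, x ∈ a -> is_subset x a) /\
  (forall x : M, x ∈ a -> ~ x ∈ x) /\
  (forall x y z : M, x ∈ a -> y ∈ a -> z ∈ a -> x ∈ y -> y ∈ z -> x ∈ z) /\
  (forall x y : M, x ∈ a -> y ∈ a -> x ∈ y \/ x = y \/ y ∈ x) /\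
  (forall b : M, is_subset b a -> ~ is_empty b ->
     exists m : M, m ∈ b /\ forall y : M, y ∈ b -> m = y \/ m ∈ y).

(** Order of the ordinals; the strict order is [∈]. *)
Definition ord_le {M : eps_structure} (a b : M) : Prop := a ∈ b \/ a = b.

Definition least_ordinal {M : eps_structure} (P : M -> Prop) (a : M) : Prop :=
  is_ordinal a /\ P a /\ forall b : M, is_ordinal b -> P b -> ord_le a b.

Definition is_cardinal {M : eps_structure} (k : M) : Prop :=
  is_ordinal k /\ forall b : M, b ∈ k -> ~ equinumerous b k.

(** [a = ℵ(X)] *)
Definition is_hartogs {M : eps_structure} (X a : M) : Prop :=
  least_ordinal (fun b => ~ card_le b X) a.

(** [a = ℵ*(X)] *)
Definition is_lindenbaum {M : eps_structure} (X a : M) : Prop :=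
  least_ordinal (fun b => ~ card_le_star b X) a.

(** [k = l⁺] *)
Definition is_card_succ {M : eps_structure} (l k : M) : Prop :=
  least_ordinal (fun b => is_cardinal b /\ l ∈ b) k.

(** [c = cf(l)]: the least ordinal [c] with a cofinal function [c -> l]. *)
Definition is_cofinality {M : eps_structure} (l c : M) : Prop :=
  least_ordinal
    (fun b => exists f : M, is_function f b l /\
       forall x : M, x ∈ l -> exists i y : M, maps_to f i y /\ ord_le x y) c.

Definition SVC {M : eps_structure} (S : M) : Prop :=
  forall X : M, exists eta P : M,
    is_ordinal eta /\ is_product P S eta /\ card_le_star X P.

(* Main.v *)
From Stdlib Require Import ClassicalEpsilon FunctionalExtensionality PeanoNat.
Require Import Defs.

(** Let a surjection of [S × η] onto [X] be given by SVC, and let [l] be a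
    cardinal with ℵ(X) ≤ l < ℵ*(X), so that [S × η] also maps onto [l].  For
    fixed [s] the image [A s] of [{s} × η] in [l] is the image of a
    well-orderable subset of [X]; hence its order type lies below ℵ(X), and the
    sets [A s] cover [l] ([svc_cover]).  Sending [(s, b)] to the [b]-th element
    of [A s] makes [l] an image of [S × ℵ(X)], or even of [S × m] if [m] bounds
    the order types ([cover_star]).

    The core is that such a factor can be dropped ([absorption]): if [k] is an
    infinite cardinal, [m < k], and [k] is an image of [S × m], then [k] is an
    image of [S].  For regular [k] one of the [m] maps [S -> k] must already have
    a large range; the point is that singular [k] are allowed, because ℵ*(S) can
    be singular and the result is applied to it.

    Granting this, suppose that ℵ*(S) < ℵ*(X).  A cardinal [l] strictly between
    ℵ(X) and ℵ*(X) is an image of [S × ℵ(X)], hence of [S], so [l < ℵ*(S)]; but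
    then ℵ*(S) is itself such a cardinal, and ℵ*(S) < ℵ*(S).  So there is no
    cardinal strictly between ([no_cardinal_between]), which gives λ = ℵ(X) and
    ℵ*(X) = λ⁺.  For the cofinality ([cofinality_lt]) consider the set of order
    types of the [A s].  If it is unbounded in λ, it is a cofinal subset of λ and
    an image of [S], so its own order type is below ℵ*(S).  If it is bounded by
    [m < λ], then λ is an image of [S × m], hence of [S], and even λ < ℵ*(S).

    To prove [absorption], let [f b : S -> k] for [b < m] have ranges that
    together cover [k], and suppose that [S] has no surjection onto [k].  Then
    every definable selection [s ↦ f (b s) s] has a range of order type below
    [k] ([range_lt]).  Call [U ⊆ S] small if the union of the [f b [U]] has
    order type below [k]; [S] is not small.  Selections built from pieces of a
    partition show two things: a partition of length below [k] into small
    pieces has a small union ([small_union]), and each [f b] has at most [m]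
    values with a fiber that is not small ([heavy_le]).  The points at which
    some [f b] takes one of its other values form a small set by the first
    fact, applied twice.  On the remaining points each [f b] has at most [m]
    values, so these are small too, and thus [S] is small.

    Sets of the model are obtained from predicates and maps of the ambient
    logic that are shown to be definable with parameters.  The cardinal
    arithmetic needed is that of well-ordered sets only: order types by
    Mostowski collapse, and [c × c ≤ c] for infinite ordinals [c]
    ([infinite_square]). *)

(** * Definability with parameters *)

Section Definability.
Context {M : eps_structure}.

Let env := nat -> M.

Definition up (r : nat -> nat) (n : nat) : nat :=
  match n with O => O | S k => S (r k) end.

Fixpoint ren (r : nat -> nat) (phi : formula) : formula :=
  match phi with
  | f_mem i j => f_mem (r i) (r j)
  | f_eq i j => f_eq (r i) (r j)
  | f_false => f_false
  | f_and p q => f_and (ren r p) (ren r q)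
  | f_or p q => f_or (ren r p) (ren r q)
  | f_imp p q => f_imp (ren r p) (ren r q)
  | f_all p => f_all (ren (up r) p)
  | f_ex p => f_ex (ren (up r) p)
  end.

Lemma scons_up (x : M) (e : env) (r : nat -> nat) :
  (fun n => scons x e (up r n)) = scons x (fun n => e (r n)).
Proof. apply functional_extensionality. intros [|n]; reflexivity. Qed.

Lemma sat_ren (phi : formula) : forall (r : nat -> nat) (e : env),
  sat e (ren r phi) <-> sat (fun n => e (r n)) phi.
Proof.
  induction phi; simpl; intros r e; try tauto;
    try (rewrite IHphi1, IHphi2; tauto).
  - split; intros H x; specialize (H x); rewrite IHphi, scons_up in *; exact H.
  - split; intros [x H]; exists x; rewrite IHphi, scons_up in *; exact H.
Qed.

Definition look (s : nat + M) (e : env) : M :=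
  match s with inl k => e k | inr c => c end.

(** [P] is given by a formula whose free variables are replaced, by [s], either
    by entries of the environment or by fixed elements of [M].  Parameters are
    thus constants and need not be listed. *)
Definition DefP (P : env -> Prop) : Prop :=
  exists (phi : formula) (s : nat -> nat + M),
    forall e, P e <-> sat (fun n => look (s n) e) phi.

Definition DefT (t : env -> M) : Prop :=
  DefP (fun e => e 0 = t (fun n => e (S n))).

Lemma DefP_ext (P Q : env -> Prop) :
  (forall e, P e <-> Q e) -> DefP Q -> DefP P.
Proof.
  intros H (phi & s & Hs). exists phi, s. intro e. rewrite H. apply Hs.
Qed.

Lemma DefP_ren (r : nat -> nat) (P : env -> Prop) :
  DefP P -> DefP (fun e => P (fun n => e (r n))).
Proof.
  intros (phi & s & Hs).
  exists phi, (fun n => match s n with inl k => inl (r k) | inr c => inr c end).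
  intro e. rewrite Hs.
  replace (fun n => look (s n) (fun k => e (r k))) with
    (fun n => look match s n with inl k => inl (r k) | inr c => inr c end e).
  - reflexivity.
  - apply functional_extensionality. intro n. destruct (s n); reflexivity.
Qed.

(** Two definable predicates can be given over one common assignment of the
    variables: even indices serve the first, odd ones the second. *)
Lemma DefP_common (P Q : env -> Prop) : DefP P -> DefP Q ->
  exists phi psi (s : nat -> nat + M), forall e,
    (P e <-> sat (fun n => look (s n) e) phi) /\
    (Q e <-> sat (fun n => look (s n) e) psi).
Proof.
  intros (phi & s & Hs) (psi & t & Ht).
  exists (ren (fun n => 2 * n) phi), (ren (fun n => S (2 * n)) psi),
    (fun n => if Nat.even n then s (Nat.div2 n) else t (Nat.div2 n)).
  intro e. split.
  - rewrite sat_ren, Hs.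
    replace (fun n => look (if Nat.even (2 * n) then _ else _) e)
      with (fun n => look (s n) e); [reflexivity|].
    apply functional_extensionality. intro n.
    rewrite Nat.even_even, Nat.div2_double. reflexivity.
  - rewrite sat_ren, Ht.
    replace (fun n => look (if Nat.even (S (2 * n)) then _ else _) e)
      with (fun n => look (t n) e); [reflexivity|].
    apply functional_extensionality. intro n.
    rewrite Nat.even_succ, Nat.odd_even, Nat.div2_succ_double. reflexivity.
Qed.

Lemma DefP_and (P Q : env -> Prop) :
  DefP P -> DefP Q -> DefP (fun e => P e /\ Q e).
Proof.
  intros HP HQ. destruct (DefP_common P Q HP HQ) as (phi & psi & s & H).
  exists (f_and phi psi), s. intro e. destruct (H e) as [H1 H2]. simpl. tauto.
Qed.

Lemma DefP_or (P Q : env -> Prop) :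
  DefP P -> DefP Q -> DefP (fun e => P e \/ Q e).
Proof.
  intros HP HQ. destruct (DefP_common P Q HP HQ) as (phi & psi & s & H).
  exists (f_or phi psi), s. intro e. destruct (H e) as [H1 H2]. simpl. tauto.
Qed.

Lemma DefP_imp (P Q : env -> Prop) :
  DefP P -> DefP Q -> DefP (fun e => P e -> Q e).
Proof.
  intros HP HQ. destruct (DefP_common P Q HP HQ) as (phi & psi & s & H).
  exists (f_imp phi psi), s. intro e. destruct (H e) as [H1 H2]. simpl. tauto.
Qed.

(** A proposition that does not mention the variables is decided once and for
    all, by excluded middle in the ambient logic. *)
Lemma DefP_const (A : Prop) : DefP (fun _ => A).
Proof.
  destruct (classic A) as [HA | HA].
  - exists (f_imp f_false f_false), (fun _ => inl 0). simpl. tauto.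
  - exists f_false, (fun _ => inl 0). simpl. tauto.
Qed.

Lemma DefP_not (P : env -> Prop) : DefP P -> DefP (fun e => ~ P e).
Proof. intro H. apply DefP_imp; [exact H | apply DefP_const]. Qed.

Lemma DefP_iff (P Q : env -> Prop) :
  DefP P -> DefP Q -> DefP (fun e => P e <-> Q e).
Proof. intros HP HQ. apply DefP_and; apply DefP_imp; assumption. Qed.

Lemma DefP_all (P : M -> env -> Prop) :
  DefP (fun e => P (e 0) (fun n => e (S n))) -> DefP (fun e => forall x, P x e).
Proof.
  intros (phi & s & Hs).
  exists (f_all (ren (fun n => match s n with inl O => O | _ => S n end) phi)),
    (fun n => match s n with inl (S k) => inl k | z => z end).
  intro e. simpl. split; intros H x; specialize (H x).
  all: change (P x e) with
    (P (scons x e 0) (fun n => scons x e (S n))) in *.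
  all: rewrite (Hs (scons x e)), sat_ren in *.
  all: match goal with
       | H : sat ?f ?p |- sat ?g ?p => replace g with f; [exact H |]
       end.
  all: apply functional_extensionality; intro n;
    destruct (s n) as [[|k]|c] eqn:E; simpl; rewrite ?E; reflexivity.
Qed.

Lemma DefP_ex (P : M -> env -> Prop) :
  DefP (fun e => P (e 0) (fun n => e (S n))) -> DefP (fun e => exists x, P x e).
Proof.
  intro H.
  apply DefP_ext with (Q := fun e => ~ forall x, ~ P x e).
  - intro e. split.
    + intros [x Hx] H'. exact (H' x Hx).
    + intro H'. apply not_all_not_ex. exact H'.
  - apply DefP_not, DefP_all, DefP_not. exact H.
Qed.

Lemma DefP_eq_look (a b : nat + M) : DefP (fun e => look a e = look b e).
Proof.
  exists (f_eq 0 1), (fun n => match n with O => a | _ => b end).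
  intro e. simpl. reflexivity.
Qed.

Lemma DefP_mem_look (a b : nat + M) : DefP (fun e => look a e ∈ look b e).
Proof.
  exists (f_mem 0 1), (fun n => match n with O => a | _ => b end).
  intro e. simpl. reflexivity.
Qed.

Lemma DefT_var (k : nat) : DefT (fun e => e k).
Proof. exact (DefP_eq_look (inl 0) (inl (S k))). Qed.

Lemma DefT_const (c : M) : DefT (fun _ => c).
Proof. exact (DefP_eq_look (inl 0) (inr c)). Qed.

Lemma DefT_ren (r : nat -> nat) (t : env -> M) :
  DefT t -> DefT (fun e => t (fun n => e (r n))).
Proof. intro H. exact (DefP_ren (up r) _ H). Qed.

Lemma DefP_subst (P : M -> env -> Prop) (t : env -> M) :
  DefP (fun e => P (e 0) (fun n => e (S n))) -> DefT t ->
  DefP (fun e => P (t e) e).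
Proof.
  intros HP Ht.
  apply DefP_ext with (Q := fun e => exists x, x = t e /\ P x e).
  - intro e. split.
    + intro H. exists (t e). auto.
    + intros (x & -> & H). exact H.
  - apply DefP_ex. apply DefP_and; assumption.
Qed.

(** Definability in the arguments alone; [P], [R] and [F] may mention further
    elements of [M] as parameters. *)
Definition def_pred (P : M -> Prop) : Prop := DefP (fun e => P (e 0)).
Definition def_rel (R : M -> M -> Prop) : Prop := DefP (fun e => R (e 0) (e 1)).
Definition def_rel3 (R : M -> M -> M -> Prop) : Prop :=
  DefP (fun e => R (e 0) (e 1) (e 2)).
Definition def_fun (F : M -> M) : Prop := DefT (fun e => F (e 0)).
Definition def_fun2 (F : M -> M -> M) : Prop := DefT (fun e => F (e 0) (e 1)).
Lemma DefP_pred (P : M -> Prop) (t : env -> M) :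
  def_pred P -> DefT t -> DefP (fun e => P (t e)).
Proof.
  intros HP Ht. apply (DefP_subst (fun x _ => P x)); [exact HP | exact Ht].
Qed.

Lemma DefP_rel (R : M -> M -> Prop) (t u : env -> M) :
  def_rel R -> DefT t -> DefT u -> DefP (fun e => R (t e) (u e)).
Proof.
  intros HR Ht Hu.
  apply (DefP_subst (fun x e => R x (u e))); [|exact Ht].
  apply (DefP_subst (fun y e => R (e 0) y) (fun e => u (fun n => e (S n)))).
  - exact (DefP_ren (fun n => match n with O => 1 | _ => 0 end) _ HR).
  - exact (DefT_ren S u Hu).
Qed.

Lemma DefP_rel3 (R : M -> M -> M -> Prop) (t u v : env -> M) :
  def_rel3 R -> DefT t -> DefT u -> DefT v ->
  DefP (fun e => R (t e) (u e) (v e)).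
Proof.
  intros HR Ht Hu Hv.
  apply (DefP_subst (fun x e => R x (u e) (v e))); [|exact Ht].
  apply (DefP_subst (fun y e => R (e 0) y (v (fun n => e (S n))))
           (fun e => u (fun n => e (S n)))); [|exact (DefT_ren S u Hu)].
  apply (DefP_subst (fun z e => R (e 1) (e 0) z)
           (fun e => v (fun n => e (S (S n)))));
    [|exact (DefT_ren (fun n => S (S n)) v Hv)].
  exact (DefP_ren
    (fun n => match n with O => 2 | S O => 1 | _ => 0 end) _ HR).
Qed.

Lemma DefT_fun (F : M -> M) (t : env -> M) :
  def_fun F -> DefT t -> DefT (fun e => F (t e)).
Proof.
  intros HF Ht.
  exact (DefP_rel (fun y x => y = F x) (fun e => e 0)
    (fun e => t (fun n => e (S n))) HF (DefT_var 0) (DefT_ren S t Ht)).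
Qed.

Lemma DefT_fun2 (F : M -> M -> M) (t u : env -> M) :
  def_fun2 F -> DefT t -> DefT u -> DefT (fun e => F (t e) (u e)).
Proof.
  intros HF Ht Hu.
  exact (DefP_rel3 (fun y x z => y = F x z) (fun e => e 0)
    (fun e => t (fun n => e (S n))) (fun e => u (fun n => e (S n)))
    HF (DefT_var 0) (DefT_ren S t Ht) (DefT_ren S u Hu)).
Qed.

Lemma DefP_mem (t u : env -> M) :
  DefT t -> DefT u -> DefP (fun e => t e ∈ u e).
Proof. apply DefP_rel. exact (DefP_mem_look (inl 0) (inl 1)). Qed.

Lemma DefP_eq (t u : env -> M) :
  DefT t -> DefT u -> DefP (fun e => t e = u e).
Proof. apply DefP_rel. exact (DefP_eq_look (inl 0) (inl 1)). Qed.

(** The two schemas, for definable predicates of the ambient logic. *)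

Lemma separation (hM : ZF M) (P : M -> Prop) (a : M) : def_pred P ->
  exists b : M, forall x : M, x ∈ b <-> x ∈ a /\ P x.
Proof.
  intros (phi & s & Hs).
  destruct (zf_separation M hM
    (ren (fun n => match s n with inl O => O | _ => S n end) phi)
    (fun n => match s n with inr c => c | _ => a end) a) as [b Hb].
  exists b. intro x. rewrite Hb, sat_ren.
  specialize (Hs (scons x (fun _ => a))). simpl in Hs. rewrite Hs.
  match goal with |- _ /\ sat ?f phi <-> _ /\ sat ?g phi =>
    replace g with f; [reflexivity|] end.
  apply functional_extensionality. intro n.
  destruct (s n) as [[|k]|c] eqn:E; simpl; rewrite ?E; reflexivity.
Qed.

Lemma replacement (hM : ZF M) (F : M -> M) (a : M) : def_fun F ->
  exists b : M, forall y : M, y ∈ b <-> exists x : M, x ∈ a /\ y = F x.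
Proof.
  intros (phi & s & Hs).
  set (psi := ren (fun n => match s n with
    inl O => O | inl (S O) => 1 | _ => S (S n) end) phi).
  set (e := fun n => match s n with inr c => c | _ => a end).
  assert (E : forall x y, sat (scons y (scons x e)) psi <-> y = F x).
  { intros x y. unfold psi. rewrite sat_ren.
    specialize (Hs (scons y (scons x (fun _ => a)))). simpl in Hs. rewrite Hs.
    match goal with |- sat ?f phi <-> sat ?g phi =>
      replace g with f; [reflexivity|] end.
    apply functional_extensionality. intro n. unfold e.
    destruct (s n) as [[|[|k]]|c] eqn:E; simpl; rewrite ?E; reflexivity. }
  destruct (zf_replacement M hM psi e a) as [b Hb].
  - intros x y y' _. rewrite !E. congruence.
  - exists b. intro y. rewrite Hb. setoid_rewrite E. reflexivity.
Qed.

End Definability.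

Section Model.
Context {M : eps_structure} (hM : ZF M).

Lemma universe_inhabited : inhabited M.
Proof. destruct (zf_infinity M hM) as [w _]. exact (inhabits w). Qed.

Definition default : M := epsilon universe_inhabited (fun _ => True).

Definition only (P : M -> Prop) (y : M) : Prop := P y /\ forall z, P z -> z = y.

(** A total description operator, hence definable whenever [P] is. *)
Definition the (P : M -> Prop) : M :=
  epsilon universe_inhabited
    (fun y => only P y \/ (~ exists z, only P z) /\ y = default).

Lemma the_graph (P : M -> Prop) (y : M) :
  y = the P <-> only P y \/ (~ exists z, only P z) /\ y = default.
Proof.
  assert (H : only P (the P) \/ (~ exists z, only P z) /\ the P = default).
  { apply (epsilon_spec universe_inhabited
      (fun y => only P y \/ (~ exists z, only P z) /\ y = default)).
    destruct (classic (exists z, only P z)) as [[z Hz] | H].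
    - exists z. left. exact Hz.
    - exists default. right. auto. }
  split.
  - intros ->. exact H.
  - destruct H as [[H H'] | [H1 H2]]; intros [[K K'] | [K1 K2]].
    + apply H'. exact K.
    + elim K1. exists (the P). split; assumption.
    + elim H1. exists y. split; assumption.
    + congruence.
Qed.

Lemma the_spec (P : M -> Prop) (y : M) : only P y -> the P = y.
Proof. intro H. symmetry. apply the_graph. auto. Qed.

Lemma DefT_the (P : (nat -> M) -> M -> Prop) :
  DefP (fun e => P (fun n => e (S n)) (e 0)) -> DefT (fun e => the (P e)).
Proof.
  intro H.
  assert (H2 : DefP (fun e => P (fun n => e (S (S n))) (e 0))).
  { exact (DefP_ren (fun n => match n with O => O | S k => S (S k) end) _ H). }
  assert (H3 : DefP (fun e => P (fun n => e (S (S (S n)))) (e 0))).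
  { exact (DefP_ren (fun n => match n with O => O | S k => S (S k) end) _ H2). }
  unfold DefT.
  eapply DefP_ext; [intro e; apply the_graph |]. unfold only.
  apply DefP_or; apply DefP_and.
  - exact H.
  - apply (DefP_all (fun z e => P (fun n => e (S n)) z -> z = e 0)).
    apply DefP_imp; [exact H2 | apply DefP_eq; apply DefT_var].
  - apply DefP_not.
    apply (DefP_ex (fun y e => P (fun n => e (S n)) y /\
      forall z, P (fun n => e (S n)) z -> z = y)).
    apply DefP_and; [exact H2|].
    apply (DefP_all (fun z e => P (fun n => e (S (S n))) z -> z = e 0)).
    apply DefP_imp; [exact H3 | apply DefP_eq; apply DefT_var].
  - apply DefP_eq; [apply DefT_var | apply DefT_const].
Qed.

(** Case distinction in the model, on a proposition of the ambient logic. *)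
Definition ite (P : Prop) (a b : M) : M :=
  the (fun y => P /\ y = a \/ ~ P /\ y = b).

Lemma ite_true (P : Prop) (a b : M) : P -> ite P a b = a.
Proof. intro H. apply the_spec. split; [auto|]. tauto. Qed.

Lemma ite_false (P : Prop) (a b : M) : ~ P -> ite P a b = b.
Proof. intro H. apply the_spec. split; [auto|]. tauto. Qed.

(** The [∈]-least element of a class of ordinals (see [least_spec]); used to
    make definable choices without the axiom of choice. *)
Definition least (P : M -> Prop) : M :=
  the (fun x => P x /\ forall y, y ∈ x -> ~ P y).

Definition sep (a : M) (P : M -> Prop) : M :=
  the (fun b => forall x, x ∈ b <-> x ∈ a /\ P x).

Definition rep (a : M) (F : M -> M) : M :=
  the (fun b => forall y, y ∈ b <-> exists x, x ∈ a /\ y = F x).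

Lemma DefT_sep (a : (nat -> M) -> M) (P : (nat -> M) -> M -> Prop) :
  DefT a -> DefP (fun e => P (fun n => e (S n)) (e 0)) ->
  DefT (fun e => sep (a e) (P e)).
Proof.
  intros Ha HP. unfold sep.
  apply (DefT_the (fun e b => forall x, x ∈ b <-> x ∈ a e /\ P e x)).
  apply (DefP_all (fun x e => x ∈ e 0 <-> x ∈ a (fun n => e (S n)) /\
    P (fun n => e (S n)) x)).
  apply DefP_iff; [apply DefP_mem; apply DefT_var | apply DefP_and].
  - apply DefP_mem; [apply DefT_var | apply (DefT_ren (fun n => S (S n)) a Ha)].
  - exact (DefP_ren (fun n => match n with O => O | S k => S (S k) end) _ HP).
Qed.

Lemma DefT_rep (a : (nat -> M) -> M) (F : (nat -> M) -> M -> M) :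
  DefT a -> DefT (fun e => F (fun n => e (S n)) (e 0)) ->
  DefT (fun e => rep (a e) (F e)).
Proof.
  intros Ha HF. unfold rep.
  apply (DefT_the (fun e b => forall y, y ∈ b <->
    exists x, x ∈ a e /\ y = F e x)).
  apply (DefP_all (fun y e => y ∈ e 0 <-> exists x, x ∈ a (fun n => e (S n)) /\
    y = F (fun n => e (S n)) x)).
  apply DefP_iff; [apply DefP_mem; apply DefT_var |].
  apply (DefP_ex (fun x e => x ∈ a (fun n => e (S (S n))) /\
    e 0 = F (fun n => e (S (S n))) x)). apply DefP_and.
  - apply DefP_mem;
      [apply DefT_var | apply (DefT_ren (fun n => S (S (S n))) a Ha)].
  - apply DefP_eq; [apply DefT_var |].
    exact (DefT_ren
      (fun n => match n with O => O | S k => S (S (S k)) end) _ HF).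
Qed.

Create HintDb defn discriminated.
(* Symbols are matched by name: unfolding them while searching can be very slow. *)
#[local] Hint Constants Opaque : defn.
#[local] Hint Variables Opaque : defn.

(* Comparison with the hypotheses is syntactic: unifying two definability
   statements up to conversion can be very slow. *)
Ltac def_hyp := 
  match goal with H : ?A |- ?B => constr_eq A B; exact H end.
Ltac def_atom := first [def_hyp | solve [typeclasses eauto 1 with defn nocore]].

(** Proves definability by recursion on the expression; a symbol without special
    treatment is looked up among the hypotheses and in the database. *)
Ltac def :=
  cbv beta;
  first
  [ def_hyp
  | lazymatch goal with
    | |- def_pred _ => unfold def_pred; def
    | |- def_rel _ => unfold def_rel; def
    | |- def_rel3 _ => unfold def_rel3; def
    | |- def_fun _ => unfold def_fun; def
    | |- def_fun2 _ => unfold def_fun2; def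
    | |- DefP (fun _ => ?A) => apply DefP_const
    | |- DefP (fun e => ~ _) => apply DefP_not; def
    | |- DefP (fun e => _ /\ _) => apply DefP_and; def
    | |- DefP (fun e => _ \/ _) => apply DefP_or; def
    | |- DefP (fun e => _ <-> _) => apply DefP_iff; def
    | |- DefP (fun e => forall x : universe M, @?P e x) =>
        apply (DefP_all (fun x e => P e x)); def
    | |- DefP (fun e => _ -> _) => apply DefP_imp; def
    | |- DefP (fun e => exists x, @?P e x) =>
        apply (DefP_ex (fun x e => P e x)); def
    | |- DefP (fun e => exists! x, _) => unfold unique; def
    | |- DefP (fun e => _ ∈ _) => apply DefP_mem; def
    | |- DefP (fun e => _ = _) => apply DefP_eq; def
    | |- DefT (fun _ => ?c) => apply DefT_const
    | |- DefT (fun e => e _) => apply DefT_var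
    | |- DefT (fun e => the (@?P e)) => apply (DefT_the P); def
    | |- DefT (fun e => ite _ _ _) => unfold ite; def
    | |- DefT (fun e => least _) => unfold least; def
    | |- DefT (fun e => sep (@?a e) (@?P e)) => apply (DefT_sep a P); def
    | |- DefT (fun e => rep (@?a e) (@?F e)) => apply (DefT_rep a F); def
    | |- _ => first
      [ lazymatch goal with |- DefP (fun e => ?R (@?t e)) =>
          apply (DefP_pred R t); [def_atom | def] end
      | lazymatch goal with |- DefP (fun e => ?R (@?t e) (@?u e)) =>
          apply (DefP_rel R t u); [def_atom | def | def] end
      | lazymatch goal with |- DefP (fun e => ?R (@?t e) (@?u e) (@?v e)) =>
          apply (DefP_rel3 R t u v); [def_atom | def | def | def] end
      | lazymatch goal with |- DefT (fun e => ?F (@?t e)) =>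
          apply (DefT_fun F t); [def_atom | def] end
      | lazymatch goal with |- DefT (fun e => ?F (@?t e) (@?u e)) =>
          apply (DefT_fun2 F t u); [def_atom | def | def] end ]
    end ].

Lemma ext (x y : M) : (forall z, z ∈ x <-> z ∈ y) -> x = y.
Proof. apply (zf_extensionality M hM). Qed.

Lemma only_set (P : M -> Prop) (b : M) : (forall x, x ∈ b <-> P x) ->
  only (fun b => forall x, x ∈ b <-> P x) b.
Proof.
  intro H. split; [exact H|]. intros c Hc. apply ext. intro z.
  rewrite H, Hc. reflexivity.
Qed.

Lemma in_sep (a : M) (P : M -> Prop) (x : M) : def_pred P ->
  (x ∈ sep a P <-> x ∈ a /\ P x).
Proof.
  intro HP. destruct (separation hM P a HP) as [b Hb].
  unfold sep. rewrite (the_spec _ b); [apply Hb | apply only_set, Hb].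
Qed.

Lemma in_rep (a : M) (F : M -> M) (y : M) : def_fun F ->
  (y ∈ rep a F <-> exists x, x ∈ a /\ y = F x).
Proof.
  intro HF. destruct (replacement hM F a HF) as [b Hb].
  unfold rep. rewrite (the_spec _ b); [apply Hb | apply only_set, Hb].
Qed.

Lemma in_rep_intro (a : M) (F : M -> M) (x : M) : def_fun F ->
  x ∈ a -> F x ∈ rep a F.
Proof. intros HF Hx. apply in_rep; [exact HF|]. exists x. auto. Qed.

(** * Pairs, functions and products *)

Definition emp : M := sep default (fun _ => False).
Definition upair (x y : M) : M := the (fun p => forall z, z ∈ p <-> z = x \/ z = y).
Definition sing (x : M) : M := upair x x.
Definition pair (x y : M) : M := upair (sing x) (upair x y).
Definition union (a : M) : M :=
  the (fun u => forall z, z ∈ u <-> exists y, y ∈ a /\ z ∈ y).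
Definition cup (a b : M) : M := union (upair a b).
Definition succ (a : M) : M := cup a (sing a).
Definition prod (A B : M) : M :=
  union (rep A (fun a => rep B (fun b => pair a b))).
Definition app (f x : M) : M := the (fun y => pair x y ∈ f).
Definition lam (D : M) (F : M -> M) : M := rep D (fun x => pair x (F x)).
Definition fst (p : M) : M := the (fun x => exists y, p = pair x y).
Definition snd (p : M) : M := the (fun y => exists x, p = pair x y).

Lemma def_upair : def_fun2 upair. Proof. unfold upair. def. Qed.
Hint Resolve def_upair : defn.
Lemma def_sing : def_fun sing. Proof. unfold sing. def. Qed.
Hint Resolve def_sing : defn.
Lemma def_pair : def_fun2 pair. Proof. unfold pair. def. Qed.
Hint Resolve def_pair : defn.
Lemma def_union : def_fun union. Proof. unfold union. def. Qed.
Hint Resolve def_union : defn.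
Lemma def_cup : def_fun2 cup. Proof. unfold cup. def. Qed.
Hint Resolve def_cup : defn.
Lemma def_succ : def_fun succ. Proof. unfold succ. def. Qed.
Hint Resolve def_succ : defn.
Lemma def_prod : def_fun2 prod. Proof. unfold prod. def. Qed.
Hint Resolve def_prod : defn.
Lemma def_app : def_fun2 app. Proof. unfold app. def. Qed.
Hint Resolve def_app : defn.
Lemma def_fst : def_fun fst. Proof. unfold fst. def. Qed.
Hint Resolve def_fst : defn.
Lemma def_snd : def_fun snd. Proof. unfold snd. def. Qed.
Hint Resolve def_snd : defn.
Lemma def_subset : def_rel (@is_subset M). Proof. unfold is_subset. def. Qed.
Hint Resolve def_subset : defn.

Lemma def_is_upair : def_rel3 (@is_upair M). Proof. unfold is_upair. def. Qed.
Hint Resolve def_is_upair : defn.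
Lemma def_is_pair : def_rel3 (@is_pair M). Proof. unfold is_pair. def. Qed.
Hint Resolve def_is_pair : defn.
Lemma def_maps_to : def_rel3 (@maps_to M). Proof. unfold maps_to. def. Qed.
Hint Resolve def_maps_to : defn.
Lemma def_is_function : def_rel3 (@is_function M).
Proof. unfold is_function. def. Qed.
Hint Resolve def_is_function : defn.
Lemma def_card_le : def_rel (@card_le M).
Proof. unfold card_le, is_injection. def. Qed.
Hint Resolve def_card_le : defn.

Lemma in_emp (x : M) : ~ x ∈ emp.
Proof. unfold emp. rewrite in_sep by def. tauto. Qed.

Lemma in_upair (z x y : M) : z ∈ upair x y <-> z = x \/ z = y.
Proof.
  destruct (zf_pairing M hM x y) as [p Hp]. unfold upair.
  rewrite (the_spec _ p); [apply Hp | apply only_set, Hp].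
Qed.

Lemma in_sing (z x : M) : z ∈ sing x <-> z = x.
Proof. unfold sing. rewrite in_upair. tauto. Qed.

Lemma in_union (z a : M) : z ∈ union a <-> exists y, y ∈ a /\ z ∈ y.
Proof.
  destruct (zf_union M hM a) as [u Hu]. unfold union.
  rewrite (the_spec _ u); [apply Hu | apply only_set, Hu].
Qed.

Lemma in_cup (z a b : M) : z ∈ cup a b <-> z ∈ a \/ z ∈ b.
Proof.
  unfold cup. rewrite in_union. setoid_rewrite in_upair. split.
  - intros (y & [-> | ->] & H); auto.
  - intros [H | H]; eauto.
Qed.

Lemma in_succ (z a : M) : z ∈ succ a <-> z ∈ a \/ z = a.
Proof. unfold succ. rewrite in_cup, in_sing. reflexivity. Qed.

Lemma is_upair_iff (p x y : M) : is_upair p x y <-> p = upair x y.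
Proof.
  split.
  - intro H. apply ext. intro z. rewrite in_upair. apply H.
  - intros -> z. apply in_upair.
Qed.

Lemma is_pair_iff (p x y : M) : is_pair p x y <-> p = pair x y.
Proof.
  unfold is_pair. setoid_rewrite is_upair_iff. split.
  - intro H. apply ext. intro z. unfold pair. rewrite in_upair. apply H.
  - intros -> z. apply in_upair.
Qed.

Lemma upair_inj_r (x y z : M) : upair x y = upair x z -> y = z.
Proof.
  intro H.
  assert (H1 : y ∈ upair x z) by (rewrite <- H; apply in_upair; auto).
  assert (H2 : z ∈ upair x y) by (rewrite H; apply in_upair; auto).
  rewrite in_upair in *. destruct H1, H2; congruence.
Qed.

Lemma pair_inj (x y x' y' : M) : pair x y = pair x' y' -> x = x' /\ y = y'.
Proof.
  intro H.
  assert (E : x = x').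
  { assert (H1 : sing x ∈ pair x' y') by (rewrite <- H; apply in_upair; auto).
    unfold pair in H1. apply in_upair in H1. destruct H1 as [H1 | H1];
      assert (H2 : x' ∈ sing x) by (rewrite H1; apply in_upair; auto);
      apply in_sing in H2; auto. }
  subst x'. split; [reflexivity|].
  exact (upair_inj_r _ _ _ (upair_inj_r _ _ _ H)).
Qed.

Lemma fst_pair (x y : M) : fst (pair x y) = x.
Proof.
  apply the_spec. split; [eauto|]. intros z [w H].
  apply pair_inj in H. symmetry. apply H.
Qed.

Lemma snd_pair (x y : M) : snd (pair x y) = y.
Proof.
  apply the_spec. split; [eauto|]. intros z [w H].
  apply pair_inj in H. symmetry. apply H.
Qed.

Lemma in_prod (p A B : M) :
  p ∈ prod A B <-> exists a b, a ∈ A /\ b ∈ B /\ p = pair a b.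
Proof.
  unfold prod. rewrite in_union. split.
  - intros (y & Hy & Hp). apply in_rep in Hy; [|def]. destruct Hy as (a & Ha & ->).
    apply in_rep in Hp; [|def]. destruct Hp as (b & Hb & ->). eauto.
  - intros (a & b & Ha & Hb & ->). exists (rep B (fun b => pair a b)). split.
    + apply in_rep; [def|]. eauto.
    + apply in_rep; [def|]. eauto.
Qed.

Lemma pair_in_prod (a b A B : M) : pair a b ∈ prod A B <-> a ∈ A /\ b ∈ B.
Proof.
  rewrite in_prod. split.
  - intros (a' & b' & Ha & Hb & H). apply pair_inj in H. destruct H as [-> ->]. auto.
  - intros [Ha Hb]. eauto.
Qed.

Lemma maps_to_iff (f x y : M) : maps_to f x y <-> pair x y ∈ f.
Proof.
  unfold maps_to. setoid_rewrite is_pair_iff. split.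
  - intros (p & -> & H). exact H.
  - eauto.
Qed.

Lemma pair_in_lam (D : M) (F : M -> M) (x y : M) : def_fun F ->
  (pair x y ∈ lam D F <-> x ∈ D /\ y = F x).
Proof.
  intro HF. unfold lam. rewrite in_rep by def. split.
  - intros (z & Hz & H). apply pair_inj in H. destruct H as [-> ->]. auto.
  - intros [Hx ->]. eauto.
Qed.

Lemma app_lam (D : M) (F : M -> M) (x : M) : def_fun F -> x ∈ D ->
  app (lam D F) x = F x.
Proof.
  intros HF Hx. apply the_spec. split.
  - apply pair_in_lam; auto.
  - intros z Hz. apply pair_in_lam in Hz; tauto.
Qed.

Lemma lam_is_function (A B : M) (F : M -> M) : def_fun F ->
  (forall x, x ∈ A -> F x ∈ B) -> is_function (lam A F) A B.
Proof.
  intros HF H. split.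
  - intros p Hp. unfold lam in Hp. apply in_rep in Hp; [|def].
    destruct Hp as (x & Hx & ->). exists x, (F x). rewrite is_pair_iff. auto.
  - intros x Hx. exists (F x). split.
    + rewrite maps_to_iff. apply pair_in_lam; auto.
    + intros y. rewrite maps_to_iff. intro Hy. apply pair_in_lam in Hy; auto.
      symmetry. apply Hy.
Qed.

Lemma app_maps_to (f A B x y : M) : is_function f A B -> maps_to f x y ->
  x ∈ A /\ y ∈ B /\ app f x = y.
Proof.
  intros [H1 H2] H. assert (H' := H). rewrite maps_to_iff in H.
  destruct (H1 _ H) as (x' & y' & Hx & Hy & E).
  rewrite is_pair_iff in E. apply pair_inj in E. destruct E as [<- <-].
  split; [exact Hx|]. split; [exact Hy|].
  apply the_spec. split; [exact H|]. intros z Hz.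
  rewrite <- maps_to_iff in Hz. destruct (H2 x Hx) as (w & _ & Hw).
  rewrite <- (Hw z Hz). apply Hw. exact H'.
Qed.

Lemma maps_to_app (f A B x : M) : is_function f A B -> x ∈ A ->
  maps_to f x (app f x) /\ app f x ∈ B.
Proof.
  intros H Hx. destruct (proj2 H x Hx) as (y & Hy & _).
  destruct (app_maps_to f A B x y H Hy) as (_ & H1 & ->). auto.
Qed.

(** Injections and surjections of the model, as definable maps.  For a
    surjection only the values in the target matter, the others can be
    redirected. *)

Lemma card_le_intro (A B : M) (F : M -> M) : def_fun F ->
  (forall x, x ∈ A -> F x ∈ B) ->
  (forall x x', x ∈ A -> x' ∈ A -> F x = F x' -> x = x') -> card_le A B.
Proof.
  intros HF H1 H2. exists (lam A F). split.
  - apply lam_is_function; assumption.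
  - intros x x' y. rewrite !maps_to_iff. intros H H'.
    apply pair_in_lam in H; [|exact HF]. apply pair_in_lam in H'; [|exact HF].
    apply H2; try tauto. destruct H, H'. congruence.
Qed.

Lemma card_le_elim (A B : M) : card_le A B -> exists F : M -> M, def_fun F /\
  (forall x, x ∈ A -> F x ∈ B) /\
  (forall x x', x ∈ A -> x' ∈ A -> F x = F x' -> x = x').
Proof.
  intros (f & Hf & Hi). exists (app f). split; [def|]. split.
  - intros x Hx. apply (maps_to_app f A B x Hf Hx).
  - intros x x' Hx Hx' E. apply (Hi x x' (app f x)).
    + apply (maps_to_app f A B x Hf Hx).
    + rewrite E. apply (maps_to_app f A B x' Hf Hx').
Qed.

Lemma card_le_star_intro (B A : M) (F : M -> M) : def_fun F ->
  (forall b, b ∈ B -> exists a, a ∈ A /\ F a = b) -> card_le_star B A.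
Proof.
  intros HF H.
  destruct (classic (exists b, b ∈ B)) as [[b0 Hb0] | Hne].
  2: { right. intros z Hz. apply Hne. eauto. }
  left.
  set (G := fun a => ite (F a ∈ B) (F a) b0).
  assert (HG : def_fun G) by (unfold G; def).
  assert (G1 : forall a, F a ∈ B -> G a = F a) by (intro a; apply ite_true).
  assert (G2 : forall a, ~ F a ∈ B -> G a = b0) by (intro a; apply ite_false).
  exists (lam A G). split.
  - apply lam_is_function; [exact HG|]. intros a Ha.
    destruct (classic (F a ∈ B)) as [K | K].
    + rewrite G1; assumption.
    + rewrite G2; assumption.
  - intros b Hb. destruct (H b Hb) as (a & Ha & <-). exists a.
    rewrite maps_to_iff. apply pair_in_lam; [exact HG|].
    split; [exact Ha|]. symmetry. apply G1. exact Hb.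
Qed.

Lemma card_le_star_elim (B A : M) : card_le_star B A -> (exists b, b ∈ B) ->
  exists F : M -> M, def_fun F /\ (forall a, a ∈ A -> F a ∈ B) /\
    (forall b, b ∈ B -> exists a, a ∈ A /\ F a = b).
Proof.
  intros [(f & Hf & Hs) | He] [b0 Hb0]; [|elim (He b0 Hb0)].
  exists (app f). split; [def|]. split.
  - intros a Ha. apply (maps_to_app f A B a Hf Ha).
  - intros b Hb. destruct (Hs b Hb) as [a Ha]. exists a.
    destruct (app_maps_to f A B a b Hf Ha) as (H1 & _ & H2). auto.
Qed.

Lemma card_le_trans (A B C : M) : card_le A B -> card_le B C -> card_le A C.
Proof.
  intros H1 H2.
  destruct (card_le_elim A B H1) as (F & HF & F1 & F2).
  destruct (card_le_elim B C H2) as (G & HG & G1 & G2).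
  apply (card_le_intro A C (fun x => G (F x))); [def | auto | auto].
Qed.

Lemma card_le_subset (A B : M) : is_subset A B -> card_le A B.
Proof. intro H. apply (card_le_intro A B (fun x => x)); [def | auto | auto]. Qed.

Lemma card_le_prod (A B C D : M) : card_le A B -> card_le C D ->
  card_le (prod A C) (prod B D).
Proof.
  intros H1 H2.
  destruct (card_le_elim A B H1) as (F & HF & F1 & F2).
  destruct (card_le_elim C D H2) as (G & HG & G1 & G2).
  apply (card_le_intro _ _ (fun p => pair (F (fst p)) (G (snd p)))); [def | |].
  - intros p Hp. apply in_prod in Hp. destruct Hp as (a & c & Ha & Hc & ->).
    rewrite fst_pair, snd_pair. apply pair_in_prod. auto.
  - intros p q Hp Hq. apply in_prod in Hp. destruct Hp as (a & c & Ha & Hc & ->).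
    apply in_prod in Hq. destruct Hq as (a' & c' & Ha' & Hc' & ->).
    rewrite !fst_pair, !snd_pair. intro E. apply pair_inj in E.
    destruct E as [E1 E2]. apply F2 in E1; auto. apply G2 in E2; auto. congruence.
Qed.

(** * Ordinals *)

Definition transitive (a : M) : Prop := forall x, x ∈ a -> is_subset x a.

(** By foundation these are the ordinals (see [is_ordinal_iff]); in this form
    there is much less to check. *)
Definition Ord (a : M) : Prop :=
  transitive a /\ forall x, x ∈ a -> transitive x.

Lemma def_transitive : def_pred transitive. Proof. unfold transitive. def. Qed.
Hint Resolve def_transitive : defn.
Lemma def_Ord : def_pred Ord. Proof. unfold Ord. def. Qed.
Hint Resolve def_Ord : defn.

Lemma mem_min (a x : M) (P : M -> Prop) : def_pred P -> x ∈ a -> P x ->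
  exists y, y ∈ a /\ P y /\ forall z, z ∈ a -> P z -> ~ z ∈ y.
Proof.
  intros HP Hx Px.
  destruct (zf_foundation M hM (sep a P)) as (y & Hy & H).
  - intro E. apply (E x). apply in_sep; auto.
  - apply in_sep in Hy; [|exact HP]. exists y. split; [apply Hy|].
    split; [apply Hy|]. intros z Hz Pz. apply H. apply in_sep; auto.
Qed.

(** Foundation for the set [{x, y}]. *)
Lemma mem_asym (x y : M) : x ∈ y -> ~ y ∈ x.
Proof.
  intros H K.
  destruct (mem_min (upair x y) x (fun _ => True)) as (z & Hz & _ & Hm);
    [def | apply in_upair; auto | auto |].
  apply in_upair in Hz. destruct Hz as [-> | ->].
  - apply (Hm y); [apply in_upair; auto | auto | exact K].
  - apply (Hm x); [apply in_upair; auto | auto | exact H].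
Qed.

Lemma mem_irrefl (x : M) : ~ x ∈ x.
Proof. intro H. exact (mem_asym x x H H). Qed.

Lemma ord_elem (a b : M) : Ord a -> b ∈ a -> Ord b.
Proof.
  intros [H1 H2] Hb. split; [apply H2, Hb|].
  intros x Hx. apply H2. apply (H1 b Hb x Hx).
Qed.

Lemma ord_trans (a b c : M) : Ord c -> a ∈ b -> b ∈ c -> a ∈ c.
Proof. intros [H _] Ha Hb. exact (H b Hb a Ha). Qed.

Lemma ord_succ (a : M) : Ord a -> Ord (succ a).
Proof.
  intros [H1 H2]. split.
  - intros x Hx z Hz. apply in_succ in Hx. apply in_succ. left.
    destruct Hx as [Hx | ->]; [exact (H1 x Hx z Hz) | exact Hz].
  - intros x Hx. apply in_succ in Hx. destruct Hx as [Hx | ->]; auto.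
Qed.

Lemma ord_least (P : M -> Prop) (a : M) : def_pred P -> Ord a -> P a ->
  exists b, Ord b /\ P b /\ (b ∈ a \/ b = a) /\ forall c, c ∈ b -> ~ P c.
Proof.
  intros HP Ha Pa.
  destruct (mem_min (succ a) a P) as (b & Hb & Pb & Hm);
    [exact HP | apply in_succ; auto | exact Pa |].
  exists b. assert (Ob := ord_elem _ _ (ord_succ a Ha) Hb).
  split; [exact Ob|]. split; [exact Pb|]. split; [apply in_succ, Hb|].
  intros c Hc Pc.
  apply (Hm c (ord_trans c b _ (ord_succ a Ha) Hc Hb) Pc Hc).
Qed.

Lemma ord_ind (P : M -> Prop) : def_pred P ->
  (forall a, Ord a -> (forall b, b ∈ a -> P b) -> P a) ->
  forall a, Ord a -> P a.
Proof.
  intros HP H a Ha. apply NNPP. intro Na.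
  destruct (ord_least (fun x => ~ P x) a) as (b & Ob & Nb & _ & Hb);
    [def | exact Ha | exact Na |].
  apply Nb. apply H; [exact Ob|]. intros c Hc. apply NNPP, Hb, Hc.
Qed.

(** By induction on [a], and for fixed [a] on [b]: if no element of [a] equals
    or exceeds [b] and vice versa, then [a] and [b] have the same elements. *)
Lemma ord_total (a b : M) : Ord a -> Ord b -> a ∈ b \/ a = b \/ b ∈ a.
Proof.
  intro Ha. revert b.
  apply (ord_ind (fun a => forall b, Ord b -> a ∈ b \/ a = b \/ b ∈ a));
    [def | | exact Ha]. clear a Ha. intros a Ha IHa.
  apply ord_ind; [def|]. intros b Hb IHb.
  destruct (classic (exists x, x ∈ a /\ (x = b \/ b ∈ x))) as [(x & Hx & K) | Na].
  { right. right. destruct K as [<- | K]; [exact Hx|].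
    exact (ord_trans _ _ _ Ha K Hx). }
  destruct (classic (exists x, x ∈ b /\ (x = a \/ a ∈ x))) as [(x & Hx & K) | Nb].
  { left. destruct K as [<- | K]; [exact Hx|].
    exact (ord_trans _ _ _ Hb K Hx). }
  right. left. apply ext. intro z. split; intro Hz.
  - destruct (IHa z Hz b Hb) as [K | K]; [exact K|].
    elim Na. exists z. tauto.
  - destruct (IHb z Hz) as [K | K]; [|destruct K as [K | K]; [|exact K]];
      elim Nb; exists z; auto.
Qed.

Lemma ord_sub (a b : M) : Ord a -> Ord b -> is_subset a b -> a ∈ b \/ a = b.
Proof.
  intros Ha Hb H. destruct (ord_total a b Ha Hb) as [K | [K | K]]; auto.
  elim (mem_irrefl b). apply H, K.
Qed.

Lemma least_spec (P : M -> Prop) (a : M) : def_pred P -> (forall x, P x -> Ord x) -> P a ->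
  P (least P) /\ forall y, y ∈ least P -> ~ P y.
Proof.
  intros HP OP Pa. destruct (ord_least P a HP (OP a Pa) Pa) as (b & Ob & Pb & _ & Hb).
  replace (least P) with b; [auto|]. symmetry. apply the_spec.
  split; [auto|]. intros z [Pz Hz].
  destruct (ord_total z b (OP z Pz) Ob) as [K | [K | K]]; [|exact K|].
  - elim (Hb z K Pz).
  - elim (Hz b K Pb).
Qed.

Lemma ord_le_sub (a b : M) : Ord b -> ord_le a b -> is_subset a b.
Proof.
  intros Hb [H | ->]; [exact (proj1 Hb a H) | intros z Hz; exact Hz].
Qed.

Lemma ord_not_lt (a b : M) : Ord a -> Ord b -> ~ a ∈ b -> is_subset b a.
Proof.
  intros Ha Hb H. apply ord_le_sub; [exact Ha|].
  destruct (ord_total a b Ha Hb) as [K | [-> | K]];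
    [contradiction | right; reflexivity | left; exact K].
Qed.

Lemma sub_lt (a b c : M) : Ord a -> Ord b -> Ord c -> is_subset a b -> b ∈ c ->
  a ∈ c.
Proof.
  intros Ha Hb Hc H K. destruct (ord_sub a b Ha Hb H) as [L | ->]; [|exact K].
  exact (ord_trans _ _ _ Hc L K).
Qed.

Lemma sub_not_lt (a b : M) : is_subset a b -> ~ b ∈ a.
Proof. intros H K. exact (mem_irrefl b (H b K)). Qed.

Lemma is_ordinal_iff (a : M) : is_ordinal a <-> Ord a.
Proof.
  split.
  - intros (H1 & _ & H3 & _). split; [exact H1|].
    intros x Hx y Hy z Hz.
    assert (Ay := H1 x Hx y Hy). exact (H3 z y x (H1 y Ay z Hz) Ay Hx Hz Hy).
  - intro Ha. split; [exact (proj1 Ha)|]. split; [intros x _; apply mem_irrefl|].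
    split; [|split].
    + intros x y z _ _ Hz Hxy Hyz.
      exact (ord_trans _ _ _ (ord_elem a z Ha Hz) Hxy Hyz).
    + intros x y Hx Hy. apply ord_total; apply (ord_elem a); assumption.
    + intros b Hb Hne. destruct (not_all_not_ex M (fun x => x ∈ b) Hne) as [x Hx].
      destruct (mem_min b x (fun _ => True)) as (m & Hm & _ & Hmin);
        [def | exact Hx | exact I |].
      exists m. split; [exact Hm|]. intros y Hy.
      destruct (ord_total m y) as [K | [K | K]]; auto.
      1, 2: apply (ord_elem a); auto.
      elim (Hmin y Hy I K).
Qed.

(** * Ranks of well-founded relations and order types *)

(** The Mostowski collapse of [R] at [x], which sends [x] to the set of the
    collapses of its predecessors.  The recursion is expressed by an
    approximation [g] that obeys it at all predecessors of [x]. *)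
Definition rank (D : M) (R : M -> M -> Prop) (x : M) : M :=
  the (fun v => exists g,
    (forall z, z ∈ D -> R z x -> app g z = rep (sep D (fun y => R y z)) (app g))
    /\ v = rep (sep D (fun y => R y x)) (app g)).

Definition well_founded_on (D : M) (R : M -> M -> Prop) : Prop :=
  (forall b, is_subset b D -> (exists x, x ∈ b) ->
     exists m, m ∈ b /\ forall y, y ∈ b -> ~ R y m) /\
  (forall x y z, x ∈ D -> y ∈ D -> z ∈ D -> R x y -> R y z -> R x z).

Lemma wf_ind (D : M) (R : M -> M -> Prop) (P : M -> Prop) :
  well_founded_on D R -> def_pred P ->
  (forall x, x ∈ D -> (forall y, y ∈ D -> R y x -> P y) -> P x) ->
  forall x, x ∈ D -> P x.
Proof.
  intros [W _] HP H x Hx. apply NNPP. intro N.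
  destruct (W (sep D (fun x => ~ P x))) as (m & Hm & Hmin).
  - intros z Hz. apply in_sep in Hz; [apply Hz | def].
  - exists x. apply in_sep; [def | auto].
  - apply in_sep in Hm; [|def]. destruct Hm as [Dm Nm]. apply Nm.
    apply H; [exact Dm|]. intros y Hy Ry. apply NNPP. intro Ny.
    apply (Hmin y); [|exact Ry]. apply in_sep; [def | auto].
Qed.

Lemma rep_ext (a : M) (F G : M -> M) : def_fun F -> def_fun G ->
  (forall x, x ∈ a -> F x = G x) -> rep a F = rep a G.
Proof.
  intros HF HG H. apply ext. intro y. rewrite !in_rep by assumption.
  split; intros (x & Hx & ->); exists x; split; auto.
  symmetry. auto.
Qed.

Section Rank.
Context (D : M) (R : M -> M -> Prop) (HR : def_rel R) (W : well_founded_on D R).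

Lemma def_rank : def_fun (rank D R). Proof. unfold rank. def. Qed.
Hint Resolve def_rank : defn.

(** Two approximations agree by induction along [R], so the value is unique; and
    the restriction of [rank] to [D] is itself an approximation. *)
Lemma rank_eq (x : M) : x ∈ D ->
  rank D R x = rep (sep D (fun y => R y x)) (rank D R).
Proof.
  revert x. apply (wf_ind D R); [exact W | def |]. intros x Hx IH.
  assert (E : forall g, (forall z, z ∈ D -> R z x ->
    app g z = rep (sep D (fun y => R y z)) (app g)) ->
    forall y, y ∈ D -> R y x -> app g y = rank D R y).
  { intros g Hg. apply (wf_ind D R (fun y => R y x -> app g y = rank D R y));
      [exact W | def |]. intros y Hy IHy Ryx.
    rewrite (Hg y Hy Ryx), (IH y Hy Ryx). apply rep_ext; [def | def |].
    intros z Hz. apply in_sep in Hz; [|def]. destruct Hz as [Dz Rz].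
    apply IHy; [exact Dz | exact Rz |].
    exact (proj2 W z y x Dz Hy Hx Rz Ryx). }
  apply the_spec. split.
  - exists (lam D (rank D R)). split.
    + intros z Hz Rz. rewrite app_lam by (def || exact Hz).
      rewrite (IH z Hz Rz). apply rep_ext; [def | def |].
      intros y Hy. apply in_sep in Hy; [|def].
      rewrite app_lam by (def || apply Hy). reflexivity.
    + apply rep_ext; [def | def |]. intros y Hy. apply in_sep in Hy; [|def].
      rewrite app_lam by (def || apply Hy). reflexivity.
  - intros v (g & Hg & ->). apply rep_ext; [def | def |].
    intros y Hy. apply in_sep in Hy; [|def]. apply E; [exact Hg | tauto | tauto].
Qed.

Lemma in_rank (x v : M) : x ∈ D ->
  (v ∈ rank D R x <-> exists y, y ∈ D /\ R y x /\ v = rank D R y).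
Proof.
  intro Hx. rewrite (rank_eq x Hx), in_rep by def. split.
  - intros (y & Hy & E). apply in_sep in Hy; [|def]. exists y. tauto.
  - intros (y & Hy & Ry & E). exists y. split; [|exact E].
    apply in_sep; [def | auto].
Qed.

Lemma rank_lt (x y : M) : x ∈ D -> y ∈ D -> R y x -> rank D R y ∈ rank D R x.
Proof. intros Hx Hy H. apply in_rank; [exact Hx|]. eauto. Qed.

Lemma rank_ord (x : M) : x ∈ D -> Ord (rank D R x).
Proof.
  revert x. apply (wf_ind D R); [exact W | def |]. intros x Hx IH. split.
  - intros w Hw v Hv. apply in_rank in Hw; [|exact Hx].
    destruct Hw as (y & Hy & Ry & ->). apply in_rank in Hv; [|exact Hy].
    destruct Hv as (z & Hz & Rz & ->). apply rank_lt; [exact Hx | exact Hz |].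
    exact (proj2 W z y x Hz Hy Hx Rz Ry).
  - intros w Hw. apply in_rank in Hw; [|exact Hx].
    destruct Hw as (y & Hy & Ry & ->). exact (proj1 (IH y Hy Ry)).
Qed.

(** For a linear order the collapse is injective, as [rank D R x] is not a member
    of itself. *)
Lemma rank_inj (L : forall x y, x ∈ D -> y ∈ D -> R x y \/ x = y \/ R y x)
  (x y : M) : x ∈ D -> y ∈ D -> rank D R x = rank D R y -> x = y.
Proof.
  intros Hx Hy E. destruct (L x y Hx Hy) as [H | [H | H]]; [|exact H|].
  - apply rank_lt in H; auto. rewrite E in H. elim (mem_irrefl _ H).
  - apply rank_lt in H; auto. rewrite E in H. elim (mem_irrefl _ H).
Qed.

End Rank.

Definition ords (A : M) : Prop := forall x, x ∈ A -> Ord x.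

(** The position of [x] in the set [A] of ordinals. *)
Definition pos (A x : M) : M := rank A (fun y z => y ∈ z) x.
Definition otp (A : M) : M := rep A (pos A).
Definition nth (A b : M) : M := the (fun a => a ∈ A /\ pos A a = b).

Lemma def_pos : def_fun2 pos. Proof. unfold pos, rank. def. Qed.
Hint Resolve def_pos : defn.
Lemma def_otp : def_fun otp. Proof. unfold otp. def. Qed.
Hint Resolve def_otp : defn.
Lemma def_nth : def_fun2 nth. Proof. unfold nth. def. Qed.
Hint Resolve def_nth : defn.

Lemma def_mem : def_rel (fun y z : M => y ∈ z). Proof. def. Qed.

Lemma ords_wf (A : M) : ords A -> well_founded_on A (fun y z => y ∈ z).
Proof.
  intro HA. split.
  - intros b _ [x Hx].
    destruct (mem_min b x (fun _ => True)) as (m & Hm & _ & Hmin);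
      [def | exact Hx | exact I |]. exists m. split; auto.
  - intros x y z _ _ Hz. apply ord_trans. exact (HA z Hz).
Qed.

Lemma ords_sub (A B : M) : ords B -> is_subset A B -> ords A.
Proof. intros HB H x Hx. apply HB, H, Hx. Qed.

Lemma ord_ords (a : M) : Ord a -> ords a.
Proof. intros Ha x. apply ord_elem, Ha. Qed.

Lemma in_pos (A x v : M) : ords A -> x ∈ A ->
  (v ∈ pos A x <-> exists y, y ∈ A /\ y ∈ x /\ v = pos A y).
Proof. intros HA Hx. apply (in_rank A _ def_mem (ords_wf A HA) x v Hx). Qed.

Lemma pos_ord (A x : M) : ords A -> x ∈ A -> Ord (pos A x).
Proof. intros HA. apply (rank_ord A _ def_mem (ords_wf A HA)). Qed.

Lemma pos_inj (A x y : M) : ords A -> x ∈ A -> y ∈ A ->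
  pos A x = pos A y -> x = y.
Proof.
  intros HA. apply (rank_inj A _ def_mem (ords_wf A HA)).
  intros u v Hu Hv. apply ord_total; apply HA; assumption.
Qed.

Lemma pos_lt (A x y : M) : ords A -> x ∈ A -> y ∈ A -> y ∈ x ->
  pos A y ∈ pos A x.
Proof. intros HA. apply (rank_lt A _ def_mem (ords_wf A HA)). Qed.

Lemma in_otp (A v : M) : v ∈ otp A <-> exists x, x ∈ A /\ v = pos A x.
Proof. unfold otp. apply in_rep. def. Qed.

Lemma pos_in_otp (A x : M) : x ∈ A -> pos A x ∈ otp A.
Proof. intro Hx. apply in_otp. eauto. Qed.

Lemma otp_ord (A : M) : ords A -> Ord (otp A).
Proof.
  intro HA. split.
  - intros v Hv w Hw. apply in_otp in Hv. destruct Hv as (x & Hx & ->).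
    apply in_pos in Hw; auto. destruct Hw as (y & Hy & _ & ->).
    apply pos_in_otp, Hy.
  - intros v Hv. apply in_otp in Hv. destruct Hv as (x & Hx & ->).
    exact (proj1 (pos_ord A x HA Hx)).
Qed.

Lemma pos_le (A x : M) : ords A -> x ∈ A -> is_subset (pos A x) x.
Proof.
  intro HA. revert x.
  apply (wf_ind A (fun y z => y ∈ z)); [exact (ords_wf A HA) | def |].
  intros x Hx IH v Hv. apply in_pos in Hv; auto. destruct Hv as (y & Hy & K & ->).
  apply (sub_lt _ y x); auto. apply pos_ord; auto.
Qed.

Lemma otp_le (A a : M) : Ord a -> is_subset A a -> is_subset (otp A) a.
Proof.
  intros Ha H v Hv. assert (HA := ords_sub A a (ord_ords a Ha) H).
  apply in_otp in Hv. destruct Hv as (x & Hx & ->).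
  apply (sub_lt _ x a); auto; [apply pos_ord; auto | apply pos_le; auto].
Qed.

Lemma pos_mono (A B x : M) : ords B -> is_subset A B -> x ∈ A ->
  is_subset (pos A x) (pos B x).
Proof.
  intros HB H. assert (HA := ords_sub A B HB H). revert x.
  apply (wf_ind A (fun y z => y ∈ z)); [exact (ords_wf A HA) | def |].
  intros x Hx IH v Hv. apply in_pos in Hv; auto. destruct Hv as (y & Hy & K & ->).
  apply (sub_lt _ (pos B y) _); auto using pos_ord, pos_lt.
Qed.

(** Order types of sets of ordinals are compared through positions: passing to a
    larger set can only raise the position of an element. *)
Lemma otp_mono (A B : M) : ords B -> is_subset A B ->
  is_subset (otp A) (otp B).
Proof.
  intros HB H v Hv. assert (HA := ords_sub A B HB H).
  apply in_otp in Hv. destruct Hv as (x & Hx & ->).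
  apply (sub_lt _ (pos B x) _); auto using pos_ord, otp_ord, pos_in_otp, pos_mono.
Qed.

Lemma pos_self (a x : M) : Ord a -> x ∈ a -> pos a x = x.
Proof.
  intro Ha. revert x. assert (HA := ord_ords a Ha).
  apply (wf_ind a (fun y z => y ∈ z)); [exact (ords_wf a HA) | def |].
  intros x Hx IH. apply ext. intro v. rewrite in_pos by auto. split.
  - intros (y & Hy & K & ->). rewrite IH; auto.
  - intro Hv. assert (K := ord_trans _ _ _ Ha Hv Hx).
    exists v. rewrite IH; auto.
Qed.

Lemma otp_self (a : M) : Ord a -> otp a = a.
Proof.
  intro Ha. apply ext. intro v. rewrite in_otp. split.
  - intros (x & Hx & ->). rewrite pos_self; auto.
  - intro Hv. exists v. rewrite pos_self; auto.
Qed.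

Lemma nth_pos (A x : M) : ords A -> x ∈ A -> nth A (pos A x) = x.
Proof.
  intros HA Hx. apply the_spec. split; [auto|]. intros z [Hz E].
  apply (pos_inj A); auto.
Qed.

Lemma nth_in (A b : M) : ords A -> b ∈ otp A ->
  nth A b ∈ A /\ pos A (nth A b) = b.
Proof.
  intros HA Hb. apply in_otp in Hb. destruct Hb as (x & Hx & ->).
  rewrite nth_pos; auto.
Qed.

Lemma otp_card_le (A : M) : ords A -> card_le (otp A) A.
Proof.
  intro HA. apply (card_le_intro _ _ (nth A)); [def | |].
  - intros x Hx. apply nth_in; auto.
  - intros x y Hx Hy E. apply nth_in in Hx; auto. apply nth_in in Hy; auto.
    destruct Hx, Hy. congruence.
Qed.

(** * Cardinals and finite sets *)

Lemma equinumerous_intro (A B : M) (F : M -> M) : def_fun F ->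
  (forall x, x ∈ A -> F x ∈ B) ->
  (forall x x', x ∈ A -> x' ∈ A -> F x = F x' -> x = x') ->
  (forall y, y ∈ B -> exists x, x ∈ A /\ F x = y) -> equinumerous A B.
Proof.
  intros HF H1 H2 H3. assert (L := lam_is_function A B F HF H1).
  exists (lam A F). split; (split; [exact L|]).
  - intros x x' y. rewrite !maps_to_iff. intros H H'.
    apply pair_in_lam in H; [|exact HF]. apply pair_in_lam in H'; [|exact HF].
    apply H2; try tauto. destruct H, H'. congruence.
  - intros y Hy. destruct (H3 y Hy) as (x & Hx & <-). exists x.
    rewrite maps_to_iff. apply pair_in_lam; auto.
Qed.

Lemma equinumerous_card_le (A B : M) : equinumerous A B -> card_le B A.
Proof.
  intros (f & [Hf Hi] & [_ Hs]).
  set (G := fun y => the (fun x => pair x y ∈ f)).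
  assert (E : forall y, y ∈ B -> maps_to f (G y) y).
  { intros y Hy. destruct (Hs y Hy) as [x Hx].
    replace (G y) with x; [exact Hx|]. symmetry. apply the_spec. split.
    - rewrite maps_to_iff in Hx. exact Hx.
    - intros z Hz. rewrite <- maps_to_iff in Hz. exact (Hi z x y Hz Hx). }
  apply (card_le_intro B A G); [unfold G; def | |].
  - intros y Hy. apply (app_maps_to f A B (G y) y Hf (E y Hy)).
  - intros y y' Hy Hy' K.
    destruct (app_maps_to f A B (G y) y Hf (E y Hy)) as (_ & _ & <-).
    rewrite K. apply (app_maps_to f A B (G y') y' Hf (E y' Hy')).
Qed.

Lemma cardinal_ord (k : M) : is_cardinal k -> Ord k.
Proof. intros [H _]. apply is_ordinal_iff, H. Qed.

(** An injection of [k] into [d] has as its range a subset of [d], whose order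
    type is at most [d] and equinumerous with [k]; this replaces an appeal to
    the Cantor-Bernstein theorem. *)
Lemma cardinal_not_le (k d : M) : is_cardinal k -> d ∈ k -> ~ card_le k d.
Proof.
  intros Hk Hd H. assert (Ok := cardinal_ord k Hk).
  destruct (card_le_elim k d H) as (F & HF & F1 & F2).
  set (A := rep k F). assert (Od := ord_elem k d Ok Hd).
  assert (AF : forall x, x ∈ k -> F x ∈ A)
    by (intros x Hx; apply in_rep_intro; auto).
  assert (SA : is_subset A d).
  { intros y Hy. apply in_rep in Hy; [|exact HF]. destruct Hy as (x & Hx & ->).
    auto. }
  assert (HA := ords_sub A d (ord_ords d Od) SA).
  assert (K : otp A ∈ k)
    by (apply (sub_lt _ d k); auto using otp_ord, otp_le).
  apply (proj2 Hk (otp A) K).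
  set (G := fun v => the (fun x => x ∈ k /\ pos A (F x) = v)).
  assert (E : forall x, x ∈ k -> G (pos A (F x)) = x).
  { intros x Hx. apply the_spec. split; [auto|]. intros z [Hz E].
    apply F2; auto. apply (pos_inj A); auto. }
  assert (S : forall v, v ∈ otp A -> exists x, x ∈ k /\ v = pos A (F x)).
  { intros v Hv. apply in_otp in Hv. destruct Hv as (y & Hy & ->).
    apply in_rep in Hy; [|exact HF]. destruct Hy as (x & Hx & ->). eauto. }
  apply (equinumerous_intro _ _ G); [unfold G; def | | |].
  - intros v Hv. destruct (S v Hv) as (x & Hx & ->). rewrite E; exact Hx.
  - intros v v' Hv Hv'. destruct (S v Hv) as (x & Hx & ->).
    destruct (S v' Hv') as (x' & Hx' & ->). rewrite !E by assumption. congruence.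
  - intros x Hx. exists (pos A (F x)). auto using pos_in_otp.
Qed.

Lemma cardinal_lt (k b d : M) : is_cardinal k -> Ord b -> d ∈ k ->
  card_le b d -> b ∈ k.
Proof.
  intros Hk Hb Hd H. apply NNPP. intro N.
  apply (cardinal_not_le k d Hk Hd). apply (card_le_trans k b d); [|exact H].
  apply card_le_subset. apply ord_not_lt; auto using cardinal_ord.
Qed.

(** Finite ordinals, as those with no nonzero limit at or below them. *)
Definition Nat (n : M) : Prop :=
  Ord n /\ forall m, m ∈ n \/ m = n -> m = emp \/ exists k, m = succ k.

Lemma def_Nat : def_pred Nat. Proof. unfold Nat. def. Qed.
Hint Resolve def_Nat : defn.

Lemma Nat_emp : Nat emp.
Proof.
  split.
  - split; intros x Hx; elim (in_emp x Hx).
  - intros m [H | ->]; [elim (in_emp m H) | auto].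
Qed.

Lemma Nat_succ (n : M) : Nat n -> Nat (succ n).
Proof.
  intros [H1 H2]. split; [apply ord_succ, H1|].
  intros m [H | ->]; [|eauto]. apply in_succ in H. auto.
Qed.

Lemma Nat_elem (n m : M) : Nat n -> m ∈ n -> Nat m.
Proof.
  intros [H1 H2] Hm. split; [exact (ord_elem n m H1 Hm)|].
  intros k [Hk | ->]; apply H2; [|auto]. left. exact (ord_trans k m n H1 Hk Hm).
Qed.

Lemma Nat_ind (P : M -> Prop) : def_pred P -> P emp ->
  (forall n, Nat n -> P n -> P (succ n)) -> forall n, Nat n -> P n.
Proof.
  intros HP H0 HS n Hn. assert (On := proj1 Hn). revert n On Hn.
  apply (ord_ind (fun n => Nat n -> P n)); [def|]. intros n On IH Hn.
  destruct (proj2 Hn n (or_intror eq_refl)) as [-> | [k ->]]; [exact H0|].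
  assert (K : k ∈ succ k) by (apply in_succ; auto).
  assert (Hk := Nat_elem _ k Hn K). apply HS; auto.
Qed.

Definition finset (A : M) : Prop := exists n, Nat n /\ card_le A n.

Lemma def_finset : def_pred finset. Proof. unfold finset. def. Qed.
Hint Resolve def_finset : defn.

Lemma finset_le (A B : M) : card_le A B -> finset B -> finset A.
Proof. intros H (n & Hn & K). exists n. split; [exact Hn|]. eapply card_le_trans; eauto. Qed.

Lemma finset_sub (A B : M) : is_subset A B -> finset B -> finset A.
Proof. intro H. apply finset_le, card_le_subset, H. Qed.

Lemma Nat_finset (n : M) : Nat n -> finset n.
Proof. intro H. exists n. split; [exact H|]. apply card_le_subset. intros z; auto. Qed.

Lemma finset_emp : finset emp.
Proof. apply Nat_finset, Nat_emp. Qed.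

Lemma finset_adj (A x : M) : finset A -> finset (cup A (sing x)).
Proof.
  intros (n & Hn & H). destruct (card_le_elim A n H) as (F & HF & F1 & F2).
  exists (succ n). split; [apply Nat_succ, Hn|].
  assert (C : forall y, y ∈ cup A (sing x) -> y ∈ A \/ ~ y ∈ A /\ y = x).
  { intros y Hy. apply in_cup in Hy. rewrite in_sing in Hy.
    destruct (classic (y ∈ A)); tauto. }
  apply (card_le_intro _ _ (fun y => ite (y ∈ A) (F y) n)); [def | |].
  - intros y Hy. apply in_succ. destruct (C y Hy) as [K | [K _]].
    + rewrite ite_true; auto.
    + rewrite ite_false; auto.
  - intros y z Hy Hz. destruct (C y Hy) as [K | [K E]], (C z Hz) as [L | [L E']];
      rewrite ?(ite_true (y ∈ A)), ?(ite_false (y ∈ A)),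
        ?(ite_true (z ∈ A)), ?(ite_false (z ∈ A)) by assumption.
    + auto.
    + intro Q. elim (mem_irrefl n). rewrite <- Q at 1. auto.
    + intro Q. elim (mem_irrefl n). rewrite Q at 1. auto.
    + congruence.
Qed.

Lemma finset_ind (P : M -> Prop) : def_pred P -> P emp ->
  (forall A x, P A -> P (cup A (sing x))) -> forall A, finset A -> P A.
Proof.
  intros HP H0 HS.
  assert (H : forall n, Nat n -> forall A, card_le A n -> P A).
  2: { intros A (n & Hn & H1). eauto. }
  apply (Nat_ind (fun n => forall A, card_le A n -> P A)); [def | |].
  - intros A H. destruct (card_le_elim _ _ H) as (F & _ & F1 & _).
    replace A with emp; [exact H0|]. apply ext. intro z. split; intro Hz.
    + elim (in_emp z Hz).
    + elim (in_emp _ (F1 z Hz)).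
  - intros n Hn IH A H. destruct (card_le_elim _ _ H) as (F & HF & F1 & F2).
    set (B := sep A (fun a => F a ∈ n)).
    assert (HB : forall a, a ∈ B <-> a ∈ A /\ F a ∈ n)
      by (intro a; apply (in_sep A (fun a => F a ∈ n)); def).
    assert (PB : P B).
    { apply IH. apply (card_le_intro _ _ F HF).
      - intros a Ha. apply HB, Ha.
      - intros a a' Ha Ha'. apply F2; [apply HB, Ha | apply HB, Ha']. }
    destruct (classic (exists a, a ∈ A /\ F a = n)) as [(a & Ha & E) | N].
    + replace A with (cup B (sing a)); [apply HS, PB|].
      apply ext. intro z. rewrite in_cup, in_sing, HB. split.
      * intros [[Hz _] | ->]; assumption.
      * intro Hz. assert (K := F1 z Hz). apply in_succ in K.
        destruct K as [K | K]; [auto|]. right. apply F2; congruence.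
    + replace A with B; [exact PB|]. apply ext. intro z. rewrite HB. split.
      * tauto.
      * intro Hz. split; [exact Hz|]. assert (K := F1 z Hz). apply in_succ in K.
        destruct K as [K | K]; [exact K|]. elim N. eauto.
Qed.

Lemma finset_cup (A B : M) : finset A -> finset B -> finset (cup A B).
Proof.
  intro HA. revert B. apply (finset_ind (fun B => finset (cup A B))); [def | |].
  - apply (finset_sub _ A); [|exact HA]. intros z Hz. apply in_cup in Hz.
    destruct Hz as [Hz | Hz]; [exact Hz | elim (in_emp z Hz)].
  - intros B x H. apply (finset_sub _ (cup (cup A B) (sing x)));
      [|apply finset_adj, H].
    intro z. rewrite !in_cup. tauto.
Qed.

Lemma finset_prod (A B : M) : finset A -> finset B -> finset (prod A B).
Proof.
  intros HA HB. revert A HA. apply (finset_ind (fun A => finset (prod A B))); [def | |].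
  - apply (finset_sub _ emp); [|exact finset_emp]. intros p Hp.
    apply in_prod in Hp. destruct Hp as (a & _ & Ha & _). elim (in_emp a Ha).
  - intros A x H. apply (finset_sub _ (cup (prod A B) (prod (sing x) B))).
    + intros p Hp. apply in_prod in Hp. destruct Hp as (a & b & Ha & Hb & ->).
      apply in_cup. rewrite !pair_in_prod. apply in_cup in Ha. tauto.
    + apply finset_cup; [exact H|]. apply (finset_le _ B); [|exact HB].
      apply (card_le_intro _ _ snd); [def | |].
      * intros p Hp. apply in_prod in Hp. destruct Hp as (a & b & _ & Hb & ->).
        rewrite snd_pair. exact Hb.
      * intros p q Hp Hq. apply in_prod in Hp, Hq.
        destruct Hp as (a & b & Ha & _ & ->), Hq as (c & d & Hc & _ & ->).
        rewrite !snd_pair. apply in_sing in Ha, Hc. congruence.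
Qed.

Lemma finset_succ (d : M) : finset d -> finset (succ d).
Proof. apply finset_adj. Qed.

Lemma finset_lt (c A : M) : Ord c -> ~ finset c -> finset A ->
  exists n, n ∈ c /\ card_le A n.
Proof.
  intros Hc Ic (n & Hn & H). exists n. split; [|exact H]. apply NNPP. intro N.
  apply Ic. apply (finset_sub c n); [|apply Nat_finset, Hn].
  apply ord_not_lt; [exact (proj1 Hn) | exact Hc | exact N].
Qed.

(** * Squares of infinite ordinals *)

Lemma ord_cup (a b : M) : Ord a -> Ord b -> cup a b = a \/ cup a b = b.
Proof.
  intros Ha Hb. destruct (classic (a ∈ b)) as [H | H].
  - right. apply ext. intro z. rewrite in_cup. split; [|auto].
    intros [Hz | Hz]; [exact (ord_trans z a b Hb Hz H) | exact Hz].
  - left. apply ord_not_lt in H; auto. apply ext. intro z. rewrite in_cup.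
    split; [|auto]. intros [Hz | Hz]; auto.
Qed.

Lemma ord_cup_in (a b c : M) : Ord c -> a ∈ c -> b ∈ c -> cup a b ∈ c.
Proof.
  intros Hc Ha Hb.
  destruct (ord_cup a b) as [-> | ->]; auto; apply (ord_elem c); assumption.
Qed.

(** Pairs compared by maximum, then by first and by second component: the
    initial segments of this order lie in squares of smaller ordinals. *)
Definition top (p : M) : M := cup (fst p) (snd p).
Definition goedel_lt (p q : M) : Prop :=
  top p ∈ top q \/ top p = top q /\
    (fst p ∈ fst q \/ fst p = fst q /\ snd p ∈ snd q).

Lemma def_top : def_fun top. Proof. unfold top. def. Qed.
Hint Resolve def_top : defn.
Lemma def_goedel_lt : def_rel goedel_lt. Proof. unfold goedel_lt. def. Qed.
Hint Resolve def_goedel_lt : defn.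

Lemma in_square (c p : M) : Ord c -> p ∈ prod c c ->
  fst p ∈ c /\ snd p ∈ c /\ Ord (fst p) /\ Ord (snd p) /\ Ord (top p) /\
  top p ∈ c /\ p = pair (fst p) (snd p).
Proof.
  intros Hc Hp. apply in_prod in Hp. destruct Hp as (a & b & Ha & Hb & ->).
  unfold top. rewrite fst_pair, snd_pair.
  assert (K := ord_cup_in a b c Hc Ha Hb).
  repeat split; auto; try (apply (ord_elem c); assumption).
  all: eapply ord_elem; eassumption.
Qed.

Lemma goedel_wf (c : M) : Ord c -> well_founded_on (prod c c) goedel_lt.
Proof.
  intro Hc. split.
  - intros b Hb [p0 Hp0].
    assert (IS := fun p Hp => in_square c p Hc (Hb p Hp)).
    destruct (ord_least (fun v => exists p, p ∈ b /\ v = top p) (top p0))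
      as (m & _ & (p1 & Hp1 & E1) & _ & M1); [def | apply IS, Hp0 | eauto |].
    destruct (ord_least (fun v => exists p, p ∈ b /\ top p = m /\ v = fst p)
      (fst p1)) as (x & _ & (p2 & Hp2 & T2 & E2) & _ & M2);
      [def | apply IS, Hp1 | eauto |].
    destruct (ord_least (fun v => exists p, p ∈ b /\ top p = m /\ fst p = x /\
      v = snd p) (snd p2)) as (y & _ & (p & Hp & T & X & Y) & _ & M3);
      [def | apply IS, Hp2 | eauto 6 |].
    exists p. split; [exact Hp|]. intros q Hq [H | [H [K | [K L]]]].
    + apply (M1 (top q)); [rewrite <- T; exact H | eauto].
    + apply (M2 (fst q)); [rewrite <- X; exact K |].
      exists q. repeat split; auto. congruence.
    + apply (M3 (snd q)); [rewrite Y; exact L |].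
      exists q. repeat split; auto; congruence.
  - intros p q r Hp Hq Hr.
    destruct (in_square c r Hc Hr) as (_ & _ & R1 & R2 & R3 & _).
    unfold goedel_lt.
    intros [H | [H [K | [K L]]]] [H' | [H' [K' | [K' L']]]];
      rewrite ?H, ?K, <- ?H', <- ?K'; eauto 6 using ord_trans.
Qed.

Lemma goedel_total (c : M) : Ord c -> forall p q, p ∈ prod c c -> q ∈ prod c c ->
  goedel_lt p q \/ p = q \/ goedel_lt q p.
Proof.
  intros Hc p q Hp Hq. unfold goedel_lt.
  destruct (in_square c p Hc Hp) as (_ & _ & P1 & P2 & P3 & _ & Ep).
  destruct (in_square c q Hc Hq) as (_ & _ & Q1 & Q2 & Q3 & _ & Eq).
  destruct (ord_total (top p) (top q) P3 Q3) as [H | [H | H]]; auto.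
  destruct (ord_total (fst p) (fst q) P1 Q1) as [K | [K | K]]; auto 6.
  destruct (ord_total (snd p) (snd q) P2 Q2) as [L | [L | L]]; auto 7.
  right. left. rewrite Ep, Eq, K, L. reflexivity.
Qed.

Lemma infinite_Nat (c n : M) : Ord c -> ~ finset c -> Nat n -> n ∈ c.
Proof.
  intros Hc Ic Hn. apply NNPP. intro N. apply Ic.
  apply (finset_sub c n); [|apply Nat_finset, Hn].
  apply ord_not_lt; [exact (proj1 Hn) | exact Hc | exact N].
Qed.

(** [succ d] embeds in [d × d] because [d] has the two elements 0 and 1. *)
Lemma infinite_succ_le (d : M) : Ord d -> ~ finset d ->
  card_le (prod d d) d -> card_le (succ d) d.
Proof.
  intros Hd Id H. apply (card_le_trans _ (prod d d)); [|exact H].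
  assert (H0 := infinite_Nat d emp Hd Id Nat_emp).
  assert (H1 := infinite_Nat d (succ emp) Hd Id (Nat_succ _ Nat_emp)).
  assert (N : succ emp <> emp).
  { intro E. apply (in_emp emp). rewrite <- E at 2. apply in_succ. auto. }
  assert (C : forall x, x ∈ succ d -> x ∈ d \/ ~ x ∈ d /\ x = d).
  { intros x Hx. apply in_succ in Hx. destruct Hx as [Hx | ->]; [auto|].
    right. split; [apply mem_irrefl | reflexivity]. }
  apply (card_le_intro _ _
    (fun x => ite (x ∈ d) (pair x emp) (pair emp (succ emp)))); [def | |].
  - intros x Hx. destruct (C x Hx) as [K | [K _]].
    + rewrite ite_true by exact K. apply pair_in_prod. auto.
    + rewrite ite_false by exact K. apply pair_in_prod. auto.
  - intros x y Hx Hy. destruct (C x Hx) as [K | [K E]], (C y Hy) as [L | [L E']];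
      rewrite ?(ite_true (x ∈ d)), ?(ite_false (x ∈ d)),
        ?(ite_true (y ∈ d)), ?(ite_false (y ∈ d)) by assumption;
      intro Q; apply pair_inj in Q; destruct Q; congruence.
Qed.

(** By induction on [c].  If [c] is not a cardinal it is equinumerous with a
    smaller infinite ordinal.  If it is, the predecessors of a pair with maximum
    [d] in the Goedel order lie in the square of [succ d], which embeds in an
    element of [c] by the induction hypothesis; so all ranks are below [c]. *)
Theorem infinite_square (c : M) : Ord c -> ~ finset c -> card_le (prod c c) c.
Proof.
  revert c. apply (ord_ind (fun c => ~ finset c -> card_le (prod c c) c)); [def|].
  intros c Hc IH Ic.
  destruct (classic (is_cardinal c)) as [Kc | Nc].
  2: { assert (H : exists d, d ∈ c /\ equinumerous d c).
       { apply NNPP. intro N. apply Nc. split; [apply is_ordinal_iff, Hc|].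
         intros d Hd E. apply N. eauto. }
       destruct H as (d & Hd & E). assert (L := equinumerous_card_le d c E).
       assert (Id : ~ finset d) by (intro Fd; apply Ic; exact (finset_le c d L Fd)).
       apply (card_le_trans _ (prod d d)); [apply card_le_prod; exact L|].
       apply (card_le_trans _ d); [exact (IH d Hd Id)|].
       exact (card_le_subset _ _ (proj1 Hc d Hd)). }
  assert (W := goedel_wf c Hc).
  assert (RI := rank_inj _ _ def_goedel_lt W (goedel_total c Hc)).
  assert (DR := def_rank (prod c c) goedel_lt def_goedel_lt).
  apply (card_le_intro _ _ (rank (prod c c) goedel_lt)); [exact DR | | exact RI].
  intros p Hp.
  destruct (in_square c p Hc Hp) as (_ & _ & _ & _ & Ot & Ct & _).
  set (d := top p) in *.
  assert (L : card_le (rank (prod c c) goedel_lt p) (prod (succ d) (succ d))).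
  { set (G := fun v => the (fun q => q ∈ prod c c /\
      rank (prod c c) goedel_lt q = v)).
    assert (GE : forall q, q ∈ prod c c -> G (rank (prod c c) goedel_lt q) = q).
    { intros q Hq. apply the_spec. split; [auto|]. intros z [Hz E]. auto. }
    assert (GP : forall v, v ∈ rank (prod c c) goedel_lt p ->
      exists q, q ∈ prod c c /\ goedel_lt q p /\
        v = rank (prod c c) goedel_lt q)
      by (intros v; apply (in_rank _ _ def_goedel_lt W p v Hp)).
    apply (card_le_intro _ _ G); [unfold G; def | |].
    - intros v Hv. destruct (GP v Hv) as (q & Hq & Q & ->). rewrite GE by exact Hq.
      destruct (in_square c q Hc Hq) as (_ & _ & O1 & O2 & O3 & _ & ->).
      assert (T : top q ∈ succ d)
        by (apply in_succ; destruct Q as [Q | [Q _]]; auto).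
      assert (Os := ord_succ d Ot).
      apply pair_in_prod; split; apply (sub_lt _ (top q)); auto;
        intros z Hz; apply in_cup; auto.
    - intros v v' Hv Hv'. destruct (GP v Hv) as (q & Hq & _ & ->).
      destruct (GP v' Hv') as (q' & Hq' & _ & ->).
      rewrite !GE by assumption. congruence. }
  assert (E : exists e, e ∈ c /\ card_le (prod (succ d) (succ d)) e).
  { destruct (classic (finset d)) as [Fd | Id].
    - apply finset_lt; auto using finset_prod, finset_succ.
    - exists d. split; [exact Ct|]. assert (Sq := IH d Ct Id).
      assert (Ls := infinite_succ_le d Ot Id Sq).
      apply (card_le_trans _ (prod d d)); [apply card_le_prod; exact Ls | exact Sq]. }
  destruct E as (e & He & Le).
  apply (cardinal_lt c _ e Kc); [|exact He|].
  - apply rank_ord; auto using def_goedel_lt.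
  - exact (card_le_trans _ _ _ L Le).
Qed.

Lemma cardinal_prod (k a b : M) : is_cardinal k -> ~ finset k -> a ∈ k -> b ∈ k ->
  exists d, d ∈ k /\ card_le (prod a b) d.
Proof.
  intros Hk Ik Ha Hb. assert (Ok := cardinal_ord k Hk).
  assert (Hc := ord_cup_in a b k Ok Ha Hb). set (c := cup a b) in *.
  assert (H : card_le (prod a b) (prod c c)).
  { apply card_le_prod; apply card_le_subset; intros z Hz; apply in_cup; auto. }
  destruct (classic (finset c)) as [Fc | Ic].
  - apply finset_lt; auto. apply (finset_le _ _ H), finset_prod; exact Fc.
  - exists c. split; [exact Hc|]. apply (card_le_trans _ _ _ H).
    apply infinite_square; [exact (ord_elem k c Ok Hc) | exact Ic].
Qed.

Lemma cardinal_succ_lt (k a : M) : is_cardinal k -> ~ finset k -> a ∈ k ->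
  succ a ∈ k.
Proof.
  intros Hk Ik Ha. assert (Ok := cardinal_ord k Hk).
  assert (Oa := ord_elem k a Ok Ha).
  assert (E : exists e, e ∈ k /\ card_le (succ a) e).
  { destruct (classic (finset a)) as [Fa | Ia].
    - apply finset_lt; auto using finset_succ.
    - exists a. split; [exact Ha|].
      apply infinite_succ_le; auto using infinite_square. }
  destruct E as (e & He & L). exact (cardinal_lt k _ e Hk (ord_succ a Oa) He L).
Qed.

(** * Absorption of a small well-orderable factor *)

Section Absorption.
Context (k m S : M) (f : M -> M -> M).
Context (Hk : is_cardinal k) (Ik : ~ finset k) (Hm : m ∈ k).
Context (Hf : def_fun2 f).
Context (f_in : forall b s, b ∈ m -> s ∈ S -> f b s ∈ k).
Context (f_onto : forall v, v ∈ k -> exists b s, b ∈ m /\ s ∈ S /\ f b s = v).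
Context (no_surj : ~ card_le_star k S).

Let Ok : Ord k := cardinal_ord k Hk.
Let Om : Ord m := ord_elem k m Ok Hm.

Definition img (b U : M) : M := rep U (f b).
Definition values (U : M) : M := union (rep m (fun b => img b U)).
Definition small (U : M) : Prop := otp (values U) ∈ k.
Definition fiber (T : M) (p : M -> M) (i : M) : M := sep T (fun s => p s = i).

Lemma def_img : def_fun2 img. Proof. unfold img. def. Qed.
Hint Resolve def_img : defn.
Lemma def_values : def_fun values. Proof. unfold values. def. Qed.
Hint Resolve def_values : defn.
Lemma def_small : def_pred small. Proof. unfold small. def. Qed.
Hint Resolve def_small : defn.

Lemma in_img (b U v : M) : v ∈ img b U <-> exists s, s ∈ U /\ v = f b s.
Proof. apply in_rep. def. Qed.

Lemma in_values (U v : M) :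
  v ∈ values U <-> exists b, b ∈ m /\ v ∈ img b U.
Proof.
  unfold values. rewrite in_union. split.
  - intros (y & Hy & Hv). apply in_rep in Hy; [|def].
    destruct Hy as (b & Hb & ->). eauto.
  - intros (b & Hb & Hv). exists (img b U). split; [|exact Hv].
    apply in_rep; [def | eauto].
Qed.

Lemma img_mono (b U V : M) : is_subset U V -> is_subset (img b U) (img b V).
Proof.
  intros H v. rewrite !in_img. intros (s & Hs & E). exists s. auto.
Qed.

Lemma img_sub (b U : M) : is_subset U S -> b ∈ m -> is_subset (img b U) k.
Proof.
  intros H Hb v Hv. apply in_img in Hv. destruct Hv as (s & Hs & ->). auto.
Qed.

Lemma values_sub (U : M) : is_subset U S -> is_subset (values U) k.
Proof.
  intros H v Hv. apply in_values in Hv. destruct Hv as (b & Hb & Hv).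
  exact (img_sub b U H Hb v Hv).
Qed.

Lemma subset_ords (A : M) : is_subset A k -> ords A.
Proof. apply ords_sub, ord_ords, Ok. Qed.

Lemma subset_otp_ord (A : M) : is_subset A k -> Ord (otp A).
Proof. intro H. apply otp_ord, subset_ords, H. Qed.

Lemma img_otp_mono (b U V : M) : b ∈ m -> is_subset V S -> is_subset U V ->
  is_subset (otp (img b U)) (otp (img b V)).
Proof.
  intros Hb HV H. apply otp_mono.
  - apply subset_ords, img_sub; assumption.
  - apply img_mono, H.
Qed.

Lemma small_mono (U V : M) : is_subset V S -> is_subset U V -> small V -> small U.
Proof.
  intros HV H K. unfold small in *.
  assert (HU : is_subset U S) by (intros z Hz; auto).
  apply (sub_lt _ (otp (values V))); auto using subset_otp_ord, values_sub.
  apply otp_mono; [apply subset_ords, values_sub, HV|].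
  intros v Hv. apply in_values in Hv. destruct Hv as (b & Hb & Hv).
  apply in_values. exists b. split; [exact Hb|]. exact (img_mono b U V H v Hv).
Qed.

(** The only use of the hypothesis that [S] does not map onto [k]: a range of
    order type [k] would give a surjection by taking positions in it. *)
Lemma range_lt (T : M) (h : M -> M) : def_fun h -> is_subset T S ->
  (forall s, s ∈ T -> h s ∈ k) -> otp (rep T h) ∈ k.
Proof.
  intros Hh HT Hk'. set (A := rep T h).
  assert (SA : is_subset A k).
  { intros v Hv. apply in_rep in Hv; [|exact Hh]. destruct Hv as (s & Hs & ->).
    auto. }
  destruct (ord_sub (otp A) k) as [H | H]; auto using subset_otp_ord, otp_le.
  elim no_surj. apply (card_le_star_intro k S (fun s => pos A (h s))); [def|].
  intros v Hv. rewrite <- H in Hv. apply in_otp in Hv.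
  destruct Hv as (x & Hx & ->). apply in_rep in Hx; [|exact Hh].
  destruct Hx as (s & Hs & ->). exists s. auto.
Qed.

Lemma range_otp_le (T U : M) (h : M -> M) (b : M) : def_fun h ->
  (forall s, s ∈ T -> h s ∈ k) ->
  is_subset U T -> (forall s, s ∈ U -> f b s = h s) ->
  is_subset (otp (img b U)) (otp (rep T h)).
Proof.
  intros Hh HT HU E. apply otp_mono.
  - apply subset_ords. intros v Hv. apply in_rep in Hv; [|exact Hh].
    destruct Hv as (s & Hs & ->). auto.
  - intros v Hv. apply in_img in Hv. destruct Hv as (s & Hs & ->).
    rewrite E by exact Hs. apply in_rep_intro; auto.
Qed.

Section Partition.
Context (T : M) (p : M -> M) (I : M).
Context (HT : is_subset T S) (Hp : def_fun p) (HI : ords I) (SI : otp I ∈ k).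
Context (p_in : forall s, s ∈ T -> p s ∈ I).

Let fib (i : M) : M := fiber T p i.

Lemma def_fib : def_fun fib. Proof. unfold fib, fiber. def. Qed.
Hint Resolve def_fib : defn.

Lemma in_fib (i s : M) : s ∈ fib i <-> s ∈ T /\ p s = i.
Proof. apply (in_sep T (fun s => p s = i) s). def. Qed.

Lemma fib_sub (i : M) : is_subset (fib i) S.
Proof. intros s Hs. apply in_fib in Hs. apply HT, Hs. Qed.

(** With a uniform bound [d] on the order types, a value [v] is determined by
    the least piece and the least [b] at which it occurs and by its position
    there; so the values of [T] embed in a product of three elements of [k].
    The bound must be on order types, not on cardinalities, as one could not
    choose the enumerations of the pieces. *)
Lemma small_uniform (d : M) : d ∈ k ->
  (forall i b, i ∈ I -> b ∈ m -> is_subset (otp (img b (fib i))) d) -> small T.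
Proof.
  intros Hd U.
  set (iv := fun v => least (fun i => i ∈ I /\ exists b, b ∈ m /\ v ∈ img b (fib i))).
  set (bv := fun v => least (fun b => b ∈ m /\ v ∈ img b (fib (iv v)))).
  assert (Di : def_fun iv) by (unfold iv; def).
  assert (Db : def_fun bv) by (unfold bv; def).
  assert (H : forall v, v ∈ values T ->
    iv v ∈ I /\ bv v ∈ m /\ v ∈ img (bv v) (fib (iv v))).
  { intros v Hv. apply in_values in Hv. destruct Hv as (b & Hb & Hv).
    apply in_img in Hv. destruct Hv as (s & Hs & ->).
    destruct (least_spec (fun i => i ∈ I /\ exists b', b' ∈ m /\
      f b s ∈ img b' (fib i)) (p s)) as [[H1 (b' & Hb' & H2)] _].
    - def.
    - intros x [Hx _]. exact (HI x Hx).
    - split; [auto|]. exists b. split; [exact Hb|]. apply in_img. exists s.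
      split; [|reflexivity]. apply in_fib. auto.
    - fold (iv (f b s)) in H1, H2. split; [exact H1|].
      apply (least_spec (fun b' => b' ∈ m /\ f b s ∈ img b' (fib (iv (f b s)))) b').
      + def.
      + intros x [Hx _]. exact (ord_elem m x Om Hx).
      + auto. }
  assert (A : forall v, v ∈ values T -> ords (img (bv v) (fib (iv v)))).
  { intros v Hv. destruct (H v Hv) as (_ & Hb & _).
    apply subset_ords, img_sub; [apply fib_sub | exact Hb]. }
  assert (L : card_le (values T) (prod (prod (otp I) m) d)).
  { apply (card_le_intro _ _ (fun v => pair (pair (pos I (iv v)) (bv v))
      (pos (img (bv v) (fib (iv v))) v))); [def | |].
    - intros v Hv. destruct (H v Hv) as (H1 & H2 & H3).
      rewrite !pair_in_prod. split; [split; [apply pos_in_otp, H1 | exact H2]|].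
      apply (U (iv v) (bv v) H1 H2). apply pos_in_otp, H3.
    - intros v w Hv Hw E. apply pair_inj in E. destruct E as [E E3].
      apply pair_inj in E. destruct E as [E1 E2].
      destruct (H v Hv) as (H1 & H2 & H3), (H w Hw) as (K1 & K2 & K3).
      apply pos_inj in E1; auto. rewrite E1, E2 in E3, H3.
      apply pos_inj in E3; auto. }
  destruct (cardinal_prod k (otp I) m Hk Ik SI Hm) as (c & Hc & Lc).
  destruct (cardinal_prod k c d Hk Ik Hc Hd) as (c' & Hc' & Lc').
  apply (cardinal_lt k _ c' Hk); [apply subset_otp_ord, values_sub, HT | exact Hc' |].
  apply (card_le_trans _ (values T)).
  { apply otp_card_le, subset_ords, values_sub, HT. }
  apply (card_le_trans _ _ _ L). apply (card_le_trans _ (prod c d)); [|exact Lc'].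
  apply card_le_prod; [exact Lc|]. apply card_le_subset. intros z; auto.
Qed.

(** Otherwise the order types of the [img b (fib i)] are unbounded in [k]
    although they are bounded for each [i].  Let [h] follow on piece [i] the
    first [f b] whose image of that piece exceeds everything seen on earlier
    pieces, and let [t] be the order type of its range.  Let [i1] be the first
    piece where [t] is exceeded, and [i2] the first where the bound [d] for
    [i1] is exceeded; then [h] is defined on [i2] and its range there already
    exceeds [t]. *)
Lemma small_union : (forall i, i ∈ I -> small (fib i)) -> small T.
Proof.
  intro HS.
  destruct (classic (exists d, d ∈ k /\ forall i b, i ∈ I -> b ∈ m ->
    is_subset (otp (img b (fib i))) d)) as [(d & Hd & U) | N].
  { exact (small_uniform d Hd U). }
  assert (OI : forall i b, b ∈ m -> Ord (otp (img b (fib i)))).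
  { intros i b Hb. apply subset_otp_ord, img_sub; [apply fib_sub | exact Hb]. }
  assert (B : forall d, d ∈ k -> exists i, (i ∈ I /\ exists b, b ∈ m /\
    d ∈ otp (img b (fib i))) /\ forall j, j ∈ i -> j ∈ I -> forall b, b ∈ m ->
    is_subset (otp (img b (fib j))) d).
  { intros d Hd. assert (Od := ord_elem k d Ok Hd).
    destruct (classic (exists i, i ∈ I /\ exists b, b ∈ m /\
      d ∈ otp (img b (fib i)))) as [(i & Hi) | N'].
    - destruct (ord_least (fun i => i ∈ I /\ exists b, b ∈ m /\
        d ∈ otp (img b (fib i))) i) as (i' & _ & Hi' & _ & Hmin);
        [def | apply HI, Hi | exact Hi |].
      exists i'. split; [exact Hi'|]. intros j Hj Ij b Hb.
      apply ord_not_lt; [exact Od | apply OI, Hb |]. intro K.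
      apply (Hmin j Hj). split; [exact Ij|]. exists b. split; assumption.
    - elim N. exists d. split; [exact Hd|]. intros i b Hi Hb.
      apply ord_not_lt; [exact Od | apply OI, Hb |]. intro K. apply N'.
      exists i. split; [exact Hi|]. exists b. split; assumption. }
  set (good := fun i b => b ∈ m /\ forall j, j ∈ I -> j ∈ i -> forall c, c ∈ m ->
    otp (img c (fib j)) ∈ otp (img b (fib i))).
  assert (Dg : def_rel good) by (unfold good; def).
  set (g := fun i => least (good i)).
  assert (Dgg : def_fun g) by (unfold g; def).
  assert (G : forall i b, good i b -> good i (g i)).
  { intros i b Hb. apply (least_spec (good i) b); [def | | exact Hb].
    intros x [Hx _]. exact (ord_elem m x Om Hx). }
  set (h := fun s => f (g (p s)) s).
  assert (Dh : def_fun h) by (unfold h; def).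
  (* A piece need not have a good [b]; [h] is meaningful only on [T']. *)
  set (T' := sep T (fun s => exists b, good (p s) b)).
  assert (HT' : forall s, s ∈ T' <-> s ∈ T /\ exists b, good (p s) b).
  { intro s. apply (in_sep T (fun s => exists b, good (p s) b)). def. }
  assert (hk : forall s, s ∈ T' -> h s ∈ k).
  { intros s Hs. apply HT' in Hs. destruct Hs as [Hs [b Hb]].
    apply f_in; [apply (G _ b Hb) | apply HT, Hs]. }
  assert (Ht : otp (rep T' h) ∈ k).
  { apply range_lt; [exact Dh | | exact hk]. intros s Hs. apply HT, HT', Hs. }
  set (t := otp (rep T' h)) in *.
  destruct (B t Ht) as (i1 & (I1 & b1 & Hb1 & K1) & M1).
  assert (Hd := HS i1 I1). unfold small in Hd.
  set (d := otp (values (fib i1))) in *.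
  assert (D1 : forall b, b ∈ m -> is_subset (otp (img b (fib i1))) d).
  { intros b Hb. apply otp_mono.
    - apply subset_ords, values_sub, fib_sub.
    - intros v Hv. apply in_values. eauto. }
  destruct (B d Hd) as (i2 & (I2 & b2 & Hb2 & K2) & M2).
  assert (L : i1 ∈ i2).
  { destruct (ord_total i1 i2 (HI i1 I1) (HI i2 I2)) as [H | [H | H]]; [exact H | |].
    - rewrite <- H in K2. elim (sub_not_lt _ _ (D1 b2 Hb2) K2).
    - elim (mem_asym t d).
      + exact (D1 b1 Hb1 t K1).
      + exact (M1 i2 H I2 b2 Hb2 d K2). }
  assert (G2 : good i2 b2).
  { split; [exact Hb2|]. intros j Hj Lj c Hc.
    apply (sub_lt _ d); [apply OI, Hc | exact (ord_elem k d Ok Hd) | apply OI, Hb2 | |].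
    - exact (M2 j Lj Hj c Hc).
    - exact K2. }
  destruct (G i2 b2 G2) as [G3 G4].
  elim (mem_asym _ _ K1).
  apply (range_otp_le T' (fib i2) h (g i2)); [exact Dh | exact hk | | |].
  - intros s Hs. apply in_fib in Hs. apply HT'. destruct Hs as [Hs <-]. eauto.
  - intros s Hs. apply in_fib in Hs. destruct Hs as [_ <-]. reflexivity.
  - apply G4; assumption.
Qed.

End Partition.

(** The partition into a single piece. *)
Lemma small_bounded (T d : M) : is_subset T S -> d ∈ k ->
  (forall b, b ∈ m -> is_subset (otp (img b T)) d) -> small T.
Proof.
  intros HT Hd U.
  assert (O1 : Ord (succ emp)) by apply (proj1 (Nat_succ _ Nat_emp)).
  apply (small_uniform T (fun _ => emp) (succ emp) HT) with (d := d).
  - def.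
  - apply ord_ords, O1.
  - rewrite otp_self by exact O1. apply infinite_Nat; auto using Nat_succ, Nat_emp.
  - intros s _. apply in_succ. auto.
  - exact Hd.
  - intros i b _ Hb v Hv. apply (U b Hb).
    apply (img_otp_mono b (fiber T (fun _ => emp) i) T Hb HT); [|exact Hv].
    intros s Hs. apply in_sep in Hs; [apply Hs | def].
Qed.

Lemma not_small_all : ~ small S.
Proof.
  unfold small. replace (values S) with k.
  - rewrite otp_self by exact Ok. apply mem_irrefl.
  - apply ext. intro v. rewrite in_values. split.
    + intro Hv. destruct (f_onto v Hv) as (b & s & Hb & Hs & <-).
      exists b. split; [exact Hb|]. apply in_img. eauto.
    + intros (b & Hb & Hv). apply (img_sub b S (fun z Hz => Hz) Hb v Hv).
Qed.

Definition heavy (b : M) : M :=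
  sep k (fun v => ~ small (sep S (fun s => f b s = v))).

Lemma def_heavy : def_fun heavy. Proof. unfold heavy. def. Qed.
Hint Resolve def_heavy : defn.

Lemma in_heavy (b v : M) :
  v ∈ heavy b <-> v ∈ k /\ ~ small (sep S (fun s => f b s = v)).
Proof. apply (in_sep k (fun v => ~ small (sep S (fun s => f b s = v)))). def. Qed.

Lemma img_lt (c : M) : c ∈ m -> otp (img c S) ∈ k.
Proof.
  intro Hc. apply range_lt; [def | intros z; auto |]. intros s Hs. auto.
Qed.

(** If [f b] had more than [m] heavy values, assign to the [c]-th one, for
    [c < m], some [f e] whose image of its fiber has larger order type than the
    whole range of [f c].  It exists as the fiber is not small.  The resulting
    selection bounds the ranges of all [f c] at once, so [S] would be small.  In
    this way the ranges themselves serve as a cofinal sequence in [k], and the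
    cofinality of [k] does not enter. *)
Lemma heavy_le (b : M) : b ∈ m -> is_subset (otp (heavy b)) m.
Proof.
  intro Hb. set (V := heavy b).
  assert (VO : is_subset V k) by (intros v Hv; apply in_heavy in Hv; apply Hv).
  assert (HV := subset_ords V VO).
  apply ord_not_lt; [exact Om | apply otp_ord, HV |]. intro Lm.
  set (fb := fun v => sep S (fun s => f b s = v)).
  assert (Dfb : def_fun fb) by (unfold fb; def).
  assert (in_fb : forall v s, s ∈ fb v <-> s ∈ S /\ f b s = v).
  { intros v s. apply (in_sep S (fun s => f b s = v)). def. }
  assert (fbS : forall v, is_subset (fb v) S) by (intros v s Hs; apply in_fb in Hs; apply Hs).
  set (good := fun v c => c ∈ m /\ otp (img (pos V v) S) ∈ otp (img c (fb v))).
  assert (Dg : def_rel good) by (unfold good; def).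
  set (g := fun v => least (good v)).
  assert (Dgg : def_fun g) by (unfold g; def).
  assert (G : forall v, v ∈ V -> pos V v ∈ m -> good v (g v)).
  { intros v Hv Hp.
    assert (E : exists c, good v c).
    { apply NNPP. intro N. apply in_heavy in Hv. apply (proj2 Hv).
      apply (small_bounded (fb v) (otp (img (pos V v) S)));
        [apply fbS | apply img_lt, Hp |].
      intros c Hc. apply ord_not_lt.
      - apply subset_otp_ord, img_sub; [intros z; auto | exact Hp].
      - apply subset_otp_ord, img_sub; [apply fbS | exact Hc].
      - intro K. apply N. exists c. split; assumption. }
    destruct E as [c Hc]. apply (least_spec (good v) c); [def | | exact Hc].
    intros x [Hx _]. exact (ord_elem m x Om Hx). }
  set (h := fun s => f (g (f b s)) s).
  assert (Dh : def_fun h) by (unfold h; def).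
  set (T := sep S (fun s => f b s ∈ V /\ pos V (f b s) ∈ m)).
  assert (HT : forall s, s ∈ T <-> s ∈ S /\ f b s ∈ V /\ pos V (f b s) ∈ m).
  { intro s. apply (in_sep S (fun s => f b s ∈ V /\ pos V (f b s) ∈ m)). def. }
  assert (hk : forall s, s ∈ T -> h s ∈ k).
  { intros s Hs. apply HT in Hs. destruct Hs as (Hs & H1 & H2).
    apply f_in; [apply (G _ H1 H2) | exact Hs]. }
  assert (Ht : otp (rep T h) ∈ k).
  { apply range_lt; [exact Dh | | exact hk]. intros s Hs. apply HT, Hs. }
  apply not_small_all. apply (small_bounded S (otp (rep T h)));
    [intros z; auto | exact Ht |].
  intros c Hc.
  destruct (nth_in V c HV) as [Nv Np].
  { exact (ord_trans c m (otp V) (otp_ord V HV) Hc Lm). }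
  set (v := nth V c) in *.
  assert (Pm : pos V v ∈ m) by (rewrite Np; exact Hc).
  destruct (G v Nv Pm) as [G1 G2]. rewrite Np in G2.
  apply ord_le_sub; [exact (ord_elem k _ Ok Ht)|]. left.
  apply (range_otp_le T (fb v) h (g v)); [exact Dh | exact hk | | | exact G2].
  - intros s Hs. apply in_fb in Hs. apply HT. destruct Hs as [Hs ->]. auto.
  - intros s Hs. apply in_fb in Hs. destruct Hs as [_ <-]. reflexivity.
Qed.

(** Partition by the value of [f b]: each light fiber is small, and the number of
    values is below [k]. *)
Lemma small_light (b : M) : b ∈ m ->
  small (sep S (fun s => ~ f b s ∈ heavy b)).
Proof.
  intro Hb. set (W := sep S (fun s => ~ f b s ∈ heavy b)).
  assert (HW : forall s, s ∈ W <-> s ∈ S /\ ~ f b s ∈ heavy b).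
  { intro s. apply (in_sep S (fun s => ~ f b s ∈ heavy b)). def. }
  set (I := sep (img b S) (fun v => ~ v ∈ heavy b)).
  assert (HI : forall v, v ∈ I <-> v ∈ img b S /\ ~ v ∈ heavy b).
  { intro v. apply (in_sep (img b S) (fun v => ~ v ∈ heavy b)). def. }
  assert (Ib : is_subset I (img b S)) by (intros v Hv; apply HI, Hv).
  assert (bk : is_subset (img b S) k) by (apply img_sub; [intros z; auto | exact Hb]).
  assert (Ik' : is_subset I k) by (intros v Hv; auto).
  apply (small_union W (f b) I).
  - intros s Hs. apply HW, Hs.
  - def.
  - apply subset_ords, Ik'.
  - apply (sub_lt _ (otp (img b S))); auto using subset_otp_ord, img_lt.
    apply otp_mono; [apply subset_ords, bk | exact Ib].
  - intros s Hs. apply HW in Hs. apply HI. split; [|apply Hs].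
    apply in_img. exists s. split; [apply Hs | reflexivity].
  - intros i Hi. apply NNPP. intro N. assert (Hi' := Hi). apply HI in Hi.
    apply (proj2 Hi). apply in_heavy. split; [auto|]. intro K. apply N.
    apply (small_mono _ (sep S (fun s => f b s = i))); [| |exact K].
    + intros s Hs. apply in_sep in Hs; [apply Hs | def].
    + intros s Hs. apply in_sep in Hs; [|def]. apply in_sep; [def|].
      split; [apply HW, Hs | apply Hs].
Qed.

(** Partition [S] by the first [b] at which [f b] takes a light value, with [m] as
    the index of the points that have no such [b]. *)
Lemma absorption_absurd : False.
Proof.
  set (P := fun s b => b ∈ m /\ ~ f b s ∈ heavy b).
  assert (DP : def_rel P) by (unfold P; def).
  set (p := fun s => ite (exists b, P s b) (least (P s)) m).
  assert (Dp : def_fun p) by (unfold p; def).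
  assert (H1 : forall s b, P s b -> p s ∈ m /\ ~ f (p s) s ∈ heavy (p s)).
  { intros s b Hb. unfold p. rewrite ite_true by eauto.
    apply (least_spec (P s) b); [def | | exact Hb].
    intros x [Hx _]. exact (ord_elem m x Om Hx). }
  assert (H2 : forall s, ~ (exists b, P s b) -> p s = m).
  { intros s Hs. apply ite_false, Hs. }
  apply not_small_all. apply (small_union S p (succ m)).
  - intros z; auto.
  - exact Dp.
  - apply ord_ords, ord_succ, Om.
  - rewrite otp_self by (apply ord_succ, Om). apply cardinal_succ_lt; assumption.
  - intros s _. apply in_succ. destruct (classic (exists b, P s b)) as [[b Hb] | N].
    + left. apply (H1 s b Hb).
    + right. apply H2, N.
  - intros i Hi. apply in_succ in Hi.
    assert (FS : is_subset (fiber S p i) S).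
    { intros s Hs. apply in_sep in Hs; [apply Hs | def]. }
    destruct Hi as [Hi | ->].
    + apply (small_mono _ (sep S (fun s => ~ f i s ∈ heavy i)));
        [| |apply small_light, Hi].
      * intros s Hs. apply in_sep in Hs; [apply Hs | def].
      * intros s Hs. apply in_sep in Hs; [|def]. destruct Hs as [Hs E].
        apply in_sep; [def|]. split; [exact Hs|].
        destruct (classic (exists b, P s b)) as [[b Hb] | N].
        -- rewrite <- E. apply (H1 s b Hb).
        -- rewrite <- E, (H2 s N) in Hi. elim (mem_irrefl m Hi).
    + apply (small_bounded _ m FS Hm). intros c Hc v Hv.
      apply (heavy_le c Hc).
      assert (HO : is_subset (heavy c) k)
        by (intros w Hw; apply in_heavy in Hw; apply Hw).
      apply (otp_mono (img c (fiber S p m)) (heavy c)); [apply subset_ords, HO | | exact Hv].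
      intros w Hw. apply in_img in Hw. destruct Hw as (s & Hs & ->).
      apply in_sep in Hs; [|def]. destruct Hs as [Hs E]. apply NNPP. intro N.
      destruct (H1 s c (conj Hc N)) as [H _]. rewrite E in H. elim (mem_irrefl m H).
Qed.

End Absorption.

Theorem absorption (k m S : M) : is_cardinal k -> ~ finset k -> m ∈ k ->
  card_le_star k (prod S m) -> card_le_star k S.
Proof.
  intros Hk Ik Hm H. apply NNPP. intro N.
  destruct (card_le_star_elim k (prod S m) H) as (F & HF & F1 & F2).
  { exists m. exact Hm. }
  apply (absorption_absurd k m S (fun b s => F (pair s b))); auto.
  - def.
  - intros b s Hb Hs. apply F1, pair_in_prod. auto.
  - intros v Hv. destruct (F2 v Hv) as (q & Hq & E). apply in_prod in Hq.
    destruct Hq as (s & b & Hs & Hb & ->). eauto.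
Qed.

(** * The dichotomy *)

Lemma hartogs_gt (X a b : M) : is_hartogs X a -> Ord b -> card_le b X -> b ∈ a.
Proof.
  intros (Ha & N & _) Hb H. apply is_ordinal_iff in Ha. apply NNPP. intro K.
  apply N. apply (card_le_trans a b X); [|exact H].
  apply card_le_subset, ord_not_lt; assumption.
Qed.

Lemma card_le_star_subset (A B C : M) : is_subset A B -> card_le_star B C ->
  card_le_star A C.
Proof.
  intros H K. destruct (classic (exists b, b ∈ B)) as [E | E].
  - destruct (card_le_star_elim B C K E) as (F & HF & _ & F2).
    apply (card_le_star_intro A C F HF). intros a Ha. auto.
  - right. intros z Hz. apply E. eauto.
Qed.

Lemma lindenbaum_iff (X a b : M) : is_lindenbaum X a -> Ord b ->
  (b ∈ a <-> card_le_star b X).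
Proof.
  intros (Ha & N & Hmin) Hb. apply is_ordinal_iff in Ha. split.
  - intro H. apply NNPP. intro K. apply is_ordinal_iff in Hb.
    destruct (Hmin b Hb K) as [L | ->].
    + exact (mem_asym a b L H).
    + exact (mem_irrefl b H).
  - intro H. apply NNPP. intro K. apply N.
    apply (card_le_star_subset a b X); [|exact H]. apply ord_not_lt; assumption.
Qed.

(** If [a] embeds in [b < a], a surjection of [X] onto [b], followed by the
    partial inverse of the embedding, covers [a]. *)
Lemma lindenbaum_cardinal (X a : M) : is_lindenbaum X a -> is_cardinal a.
Proof.
  intro H. assert (Ha := proj1 H). split; [exact Ha|].
  assert (Oa := proj1 (is_ordinal_iff a) Ha). intros b Hb E.
  assert (Ob := ord_elem a b Oa Hb). apply (proj1 (proj2 H)).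
  assert (Lb := proj1 (lindenbaum_iff X a b H Ob) Hb).
  destruct (card_le_elim a b (equinumerous_card_le b a E)) as (G & HG & G1 & G2).
  assert (Nb : exists z, z ∈ b) by (exists (G b); apply G1, Hb).
  destruct (card_le_star_elim b X Lb Nb) as (F & HF & _ & F2).
  apply (card_le_star_intro a X (fun x => the (fun y => y ∈ a /\ G y = F x)));
    [def|].
  intros y Hy. destruct (F2 (G y) (G1 y Hy)) as (x & Hx & E').
  exists x. split; [exact Hx|]. apply the_spec. split; [auto|].
  intros z [Hz Ez]. apply G2; congruence.
Qed.

(** Finite choice, which excludes that ℵ(X) is finite. *)
Lemma finset_section (X : M) (g : M -> M) : def_fun g -> forall A, finset A ->
  (forall a, a ∈ A -> exists x, x ∈ X /\ g x = a) ->
  exists j, forall a, a ∈ A -> app j a ∈ X /\ g (app j a) = a.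
Proof.
  intros Hg.
  apply (finset_ind (fun A => (forall a, a ∈ A -> exists x, x ∈ X /\ g x = a) ->
    exists j, forall a, a ∈ A -> app j a ∈ X /\ g (app j a) = a)); [def | |].
  - intros _. exists emp. intros a Ha. elim (in_emp a Ha).
  - intros A y IH H.
    destruct IH as [j Hj]; [intros a Ha; apply H, in_cup; auto|].
    destruct (H y) as (x & Hx & E); [apply in_cup; rewrite in_sing; auto|].
    exists (lam (cup A (sing y)) (fun a => ite (a = y) x (app j a))).
    intros a Ha. rewrite app_lam by (def || exact Ha).
    destruct (classic (a = y)) as [-> | N].
    + rewrite ite_true; auto.
    + rewrite ite_false by exact N. apply Hj. apply in_cup in Ha.
      rewrite in_sing in Ha. tauto.
Qed.

(** [X] maps onto [a] because it maps onto [l]; were [a] finite, a section would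
    embed it in [X]. *)
Lemma hartogs_infinite (X a l : M) : is_hartogs X a -> Ord l -> ord_le a l ->
  card_le_star l X -> ~ finset a.
Proof.
  intros (_ & N & _) Ol Hal Hl Fa. apply N.
  assert (Ha := card_le_star_subset a l X (ord_le_sub a l Ol Hal) Hl).
  destruct (classic (exists z, z ∈ a)) as [E | E].
  - destruct (card_le_star_elim a X Ha E) as (g & Hg & _ & G2).
    destruct (finset_section X g Hg a Fa G2) as [j Hj].
    apply (card_le_intro a X (app j)); [def | |].
    + intros z Hz. apply Hj, Hz.
    + intros z z' Hz Hz' K. destruct (Hj z Hz) as [_ <-], (Hj z' Hz') as [_ <-].
      congruence.
  - apply card_le_subset. intros z Hz. elim E. eauto.
Qed.

Lemma is_product_eq (P A B : M) : is_product P A B -> P = prod A B.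
Proof.
  intro H. apply ext. intro p. rewrite in_prod. unfold is_product in H. rewrite H.
  setoid_rewrite is_pair_iff. reflexivity.
Qed.

(** A value in [A s] is attained at a least ordinal of [η]; the point of [X]
    found there depends injectively on the value, since the map to [l] recovers
    it.  So the order type of [A s] embeds in [X]. *)
Lemma svc_cover (S X a l : M) : SVC S -> is_hartogs X a -> Ord l ->
  (exists z, z ∈ l) -> card_le_star l X ->
  exists A : M -> M, def_fun A /\
    (forall s, s ∈ S -> is_subset (A s) l /\ otp (A s) ∈ a) /\
    (forall v, v ∈ l -> exists s, s ∈ S /\ v ∈ A s).
Proof.
  intros HS HX Ol Nl Hl. destruct (HS X) as (eta & P & Oe & HP & HXP).
  apply is_product_eq in HP. subst P. apply is_ordinal_iff in Oe.
  destruct (card_le_star_elim l X Hl Nl) as (g & Hg & G1 & G2).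
  assert (NX : exists x, x ∈ X).
  { destruct Nl as [z Hz]. destruct (G2 z Hz) as (x & Hx & _). eauto. }
  destruct (card_le_star_elim X _ HXP NX) as (f & Hf & F1 & F2).
  assert (F1' : forall s e, s ∈ S -> e ∈ eta -> f (pair s e) ∈ X)
    by (intros s e Hs He; apply F1, pair_in_prod; auto).
  set (A := fun s => rep eta (fun e => g (f (pair s e)))).
  assert (DA : def_fun A) by (unfold A; def).
  assert (in_A : forall s v, v ∈ A s <-> exists e, e ∈ eta /\ v = g (f (pair s e))).
  { intros s v. apply (in_rep eta (fun e => g (f (pair s e))) v). def. }
  assert (SA : forall s, s ∈ S -> is_subset (A s) l).
  { intros s Hs v Hv. apply in_A in Hv. destruct Hv as (e & He & ->). auto. }
  exists A. split; [exact DA|]. split.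
  - intros s Hs. split; [exact (SA s Hs)|].
    assert (HA := ords_sub _ _ (ord_ords l Ol) (SA s Hs)).
    apply (hartogs_gt X a _ HX); [apply otp_ord, HA|].
    apply (card_le_trans _ (A s)); [apply otp_card_le, HA|].
    set (ev := fun v => least (fun e => e ∈ eta /\ v = g (f (pair s e)))).
    assert (EV : forall v, v ∈ A s -> ev v ∈ eta /\ v = g (f (pair s (ev v)))).
    { intros v Hv. apply in_A in Hv. destruct Hv as (e & He).
      apply (least_spec (fun e => e ∈ eta /\ v = g (f (pair s e))) e);
        [def | | exact He].
      intros x [Hx _]. exact (ord_elem eta x Oe Hx). }
    apply (card_le_intro _ _ (fun v => f (pair s (ev v)))); [unfold ev; def | |].
    + intros v Hv. apply F1'; [exact Hs | apply EV, Hv].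
    + intros v w Hv Hw E. rewrite (proj2 (EV v Hv)), (proj2 (EV w Hw)).
      congruence.
  - intros v Hv. destruct (G2 v Hv) as (x & Hx & <-).
    destruct (F2 x Hx) as (p & Hp & <-). apply in_prod in Hp.
    destruct Hp as (s & e & Hs & He & ->). exists s. split; [exact Hs|].
    apply in_A. eauto.
Qed.

Lemma cover_star (S l m : M) (A : M -> M) : def_fun A -> Ord l ->
  (forall s, s ∈ S -> is_subset (A s) l /\ is_subset (otp (A s)) m) ->
  (forall v, v ∈ l -> exists s, s ∈ S /\ v ∈ A s) -> card_le_star l (prod S m).
Proof.
  intros HA Ol H1 H2.
  apply (card_le_star_intro _ _ (fun p => nth (A (fst p)) (snd p))); [def|].
  intros v Hv. destruct (H2 v Hv) as (s & Hs & Hv'). destruct (H1 s Hs) as [K1 K2].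
  exists (pair s (pos (A s) v)). rewrite fst_pair, snd_pair. split.
  - apply pair_in_prod. split; [exact Hs|]. apply K2, pos_in_otp, Hv'.
  - apply nth_pos; [|exact Hv']. exact (ords_sub _ _ (ord_ords l Ol) K1).
Qed.

Definition has_cofinal (l b : M) : Prop :=
  exists f : M, is_function f b l /\
    forall x : M, x ∈ l -> exists i y : M, maps_to f i y /\ ord_le x y.

Lemma def_has_cofinal : def_rel has_cofinal.
Proof. unfold has_cofinal, ord_le. def. Qed.
Hint Resolve def_has_cofinal : defn.

Lemma cofinality_le (l b : M) (F : M -> M) : def_fun F -> Ord b ->
  (forall i, i ∈ b -> F i ∈ l) ->
  (forall x, x ∈ l -> exists i, i ∈ b /\ ord_le x (F i)) ->
  exists c, is_cofinality l c /\ ord_le c b.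
Proof.
  intros HF Ob F1 F2.
  destruct (ord_least (has_cofinal l) b) as (c & Oc & Hc & Lc & Hmin);
    [def | exact Ob | |].
  - exists (lam b F). split; [apply lam_is_function; assumption|].
    intros x Hx. destruct (F2 x Hx) as (i & Hi & L). exists i, (F i).
    split; [|exact L]. rewrite maps_to_iff. apply pair_in_lam; auto.
  - exists c. split; [|exact Lc]. split; [apply is_ordinal_iff, Oc|].
    split; [exact Hc|]. intros d Od Hd. apply is_ordinal_iff in Od.
    destruct (ord_total c d Oc Od) as [K | [K | K]]; [left | right |]; auto.
    elim (Hmin d K Hd).
Qed.

Lemma cofinality_lt (S X l k : M) : SVC S -> is_hartogs X l -> is_cardinal l ->
  ~ finset l -> card_le_star l X -> is_lindenbaum S k ->
  exists c, is_cofinality l c /\ c ∈ k.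
Proof.
  intros HS HX Kl Il Hl Hk. assert (Ol := cardinal_ord l Kl).
  assert (Ok := proj1 (is_ordinal_iff k) (proj1 Hk)).
  destruct (svc_cover S X l l HS HX Ol) as (A & DA & A1 & A2);
    [exists emp; apply infinite_Nat; auto using Nat_emp | exact Hl |].
  assert (LT : forall c b, ord_le c b -> b ∈ k -> c ∈ k).
  { intros c b [H | ->] Hb; [exact (ord_trans c b k Ok H Hb) | exact Hb]. }
  destruct (classic (exists x, x ∈ l /\ forall s, s ∈ S -> is_subset (otp (A s)) x))
    as [(x & Hx & B) | N].
  - assert (Hlk : l ∈ k).
    { apply (lindenbaum_iff S k l Hk Ol). apply (absorption l x S Kl Il Hx).
      apply (cover_star S l x A DA Ol); [|exact A2].
      intros s Hs. split; [apply A1, Hs | apply B, Hs]. }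
    destruct (cofinality_le l l (fun x => x)) as (c & Hc & Lc); [def | exact Ol | | |].
    + auto.
    + intros z Hz. exists z. split; [exact Hz | right; reflexivity].
    + exists c. split; [exact Hc | exact (LT c l Lc Hlk)].
  - set (T := rep S (fun s => otp (A s))).
    assert (in_T : forall v, v ∈ T <-> exists s, s ∈ S /\ v = otp (A s)).
    { intro v. apply (in_rep S (fun s => otp (A s)) v). def. }
    assert (ST : is_subset T l).
    { intros v Hv. apply in_T in Hv. destruct Hv as (s & Hs & ->). apply A1, Hs. }
    assert (HT := ords_sub T l (ord_ords l Ol) ST).
    assert (Ot := otp_ord T HT).
    assert (Htk : otp T ∈ k).
    { apply (lindenbaum_iff S k _ Hk Ot).
      apply (card_le_star_intro _ _ (fun s => pos T (otp (A s)))); [def|].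
      intros v Hv. apply in_otp in Hv. destruct Hv as (y & Hy & ->).
      apply in_T in Hy. destruct Hy as (s & Hs & ->). eauto. }
    destruct (cofinality_le l (otp T) (nth T)) as (c & Hc & Lc); [def | exact Ot | | |].
    + intros i Hi. apply ST, nth_in; assumption.
    + intros x Hx. apply NNPP. intro N'. apply N. exists x. split; [exact Hx|].
      intros s Hs. assert (Hv : otp (A s) ∈ T) by (apply in_T; eauto).
      assert (Ox := ord_elem l x Ol Hx).
      destruct (ord_total (otp (A s)) x (HT _ Hv) Ox) as [K | K].
      * exact (proj1 Ox _ K).
      * elim N'. exists (pos T (otp (A s))). split; [apply pos_in_otp, Hv|].
        rewrite nth_pos by assumption. unfold ord_le.
        destruct K as [K | K]; auto.
    + exists c. split; [exact Hc | exact (LT c _ Lc Htk)].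
Qed.

(** All cardinals strictly between ℵ(X) and ℵ*(X) are below ℵ*(S).  If there were
    one, ℵ*(S) would be one of them. *)
Lemma no_cardinal_between (S X a L k l : M) : SVC S -> is_hartogs X a ->
  is_lindenbaum X L -> is_lindenbaum S k -> k ∈ L -> ~ finset a ->
  is_cardinal l -> a ∈ l -> ~ l ∈ L.
Proof.
  intros HS HX HL Hk HkL Ia.
  assert (H : forall l, is_cardinal l -> a ∈ l -> l ∈ L -> l ∈ k).
  { clear l. intros l Kl Hal HlL. assert (Ol := cardinal_ord l Kl).
    assert (Il : ~ finset l).
    { intro F. apply Ia. apply (finset_sub a l); [exact (proj1 Ol a Hal) | exact F]. }
    apply (lindenbaum_iff S k l Hk Ol). apply (absorption l a S Kl Il Hal).
    destruct (svc_cover S X a l HS HX Ol) as (A & DA & A1 & A2); [eauto | |].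
    - apply (lindenbaum_iff X L l HL Ol), HlL.
    - apply (cover_star S l a A DA Ol); [|exact A2]. intros s Hs.
      split; [apply A1, Hs|].
      apply (proj1 (ord_elem l a Ol Hal)). apply A1, Hs. }
  intros Kl Hal HlL. assert (Hlk := H l Kl Hal HlL).
  assert (Kk := lindenbaum_cardinal S k Hk).
  apply (mem_irrefl k). apply H; [exact Kk | | exact HkL].
  exact (ord_trans a l k (cardinal_ord k Kk) Hal Hlk).
Qed.

End Model.

Theorem corollary1p6 (M : eps_structure) (hM : ZF M)
    (S : M) (hS : SVC S)
    (X lambda : M) (hlambda : is_cardinal lambda)
    (alephX alephstarX alephstarS : M)
    (hX : is_hartogs X alephX)
    (hstarX : is_lindenbaum X alephstarX)
    (hstarS : is_lindenbaum S alephstarS)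
    (hle : ord_le alephX lambda) (hlt : lambda ∈ alephstarX) :
  ord_le alephstarX alephstarS
  \/
  (lambda = alephX /\ alephX ∈ alephstarX /\ is_card_succ lambda alephstarX /\
   exists c : M, is_cofinality lambda c /\ c ∈ alephstarS).
Proof.
  assert (Ol := cardinal_ord hM lambda hlambda).
  assert (OX := proj1 (is_ordinal_iff hM _) (proj1 hstarX)).
  assert (OS := proj1 (is_ordinal_iff hM _) (proj1 hstarS)).
  assert (Sl := proj1 (lindenbaum_iff hM X _ lambda hstarX Ol) hlt).
  assert (Ia := hartogs_infinite hM X alephX lambda hX Ol hle Sl).
  destruct (ord_total hM _ _ OX OS) as [H | [H | H]];
    [left; left; exact H | left; right; exact H | right].
  assert (gap : forall b, is_cardinal b -> alephX ∈ b -> ~ b ∈ alephstarX).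
  { intro b. exact (no_cardinal_between hM S X _ _ _ b hS hX hstarX hstarS H Ia). }
  assert (E : lambda = alephX).
  { destruct hle as [K | K]; [|symmetry; exact K].
    elim (gap lambda hlambda K hlt). }
  subst alephX. split; [reflexivity|]. split; [exact hlt|]. split.
  - split; [exact (proj1 hstarX)|]. split.
    + split; [exact (lindenbaum_cardinal hM X _ hstarX) | exact hlt].
    + intros b Ob [Kb Lb]. apply (is_ordinal_iff hM) in Ob.
      destruct (ord_total hM _ _ OX Ob) as [K | [K | K]];
        [left; exact K | right; exact K | elim (gap b Kb Lb K)].
  - exact (cofinality_lt hM S X lambda _ hS hX hlambda Ia Sl hstarS).
Qed.
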